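(* Let $(\mathcal{X},T)$ be a dynamical system with a metric $d$ and a $T$-invariant Borel probability measure $\mu$. Then $$\mathrm{mdim}(\mathcal{X},T)\le\mathrm{mdim}_{\mathrm{H}}(\mathcal{X},T,d)\le\underline{\mathrm{mdim}}_{\mathrm{M}}(\mathcal{X},T,d),$$ and $$\overline{\mathrm{rdim}}(\mathcal{X},T,d,\mu)\le\overline{\mathrm{mdim}}_{\mathrm{M}}(\mathcal{X},T,d),\qquad \underline{\mathrm{rdim}}(\mathcal{X},T,d,\mu)\le\underline{\mathrm{mdim}}_{\mathrm{M}}(\mathcal{X},T,d).$$
   Context: A dynamical system $(\mathcal{X},T)$ is a compact metrizable space $\mathcal{X}$ with a homeomorphism $T:\mathcal{X}\to\mathcal{X}$. Metrics on $\mathcal{X}$ are assumed compatible with the topology. Logarithms $\log$ are to base two. Quantities take values in $[0,\infty]$. For a metric $d$ put $d_N(x,y)=\max_{0\le n<N}d(T^nx,T^ny)$. Mean dimension: a continuous map $f:\mathcal{X}\to\mathcal{Y}$ from a compact metric space $(\mathcal{X},d)$ to a topological space is an $\varepsilon$-embedding if $\mathrm{diam}\,f^{-1}(y)<\varepsilon$ for every $y\in\mathcal{Y}$; $\mathrm{Widim}_\varepsilon(\mathcal{X},d)$ is the minimum $n\ge0$ such that there is an $\varepsilon$-embedding of $\mathcal{X}$ into some $n$-dimensional finite simplicial complex. $\mathrm{mdim}(\mathcal{X},T)=\lim_{\varepsilon\to0}\big(\lim_{N\to\infty}\mathrm{Widim}_\varepsilon(\mathcal{X},d_N)/N\big)$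 (limits exist; the value is independent of $d$). Metric mean dimension: $\#(\mathcal{X},d,\varepsilon)$ is the minimum $n\ge1$ such that $\mathcal{X}$ has an open cover $\{U_1,\dots,U_n\}$ with $\mathrm{diam}\,U_i<\varepsilon$ for all $i$; $S(\mathcal{X},T,d,\varepsilon)=\lim_{N\to\infty}\frac1N\log\#(\mathcal{X},d_N,\varepsilon)$; $\overline{\mathrm{mdim}}_{\mathrm{M}}(\mathcal{X},T,d)$ and $\underline{\mathrm{mdim}}_{\mathrm{M}}(\mathcal{X},T,d)$ are the $\limsup$ and $\liminf$ as $\varepsilon\to0$ of $S(\mathcal{X},T,d,\varepsilon)/\log(1/\varepsilon)$. Mean Hausdorff dimension: for a compact metric space $(\mathcal{X},d)$, $s\ge0$, $\varepsilon>0$, $\mathcal{H}^s_\varepsilon(\mathcal{X},d)=\inf\{\sum_{n=1}^\infty(\mathrm{diam}\,E_n)^s : \mathcal{X}=\bigcup_{n=1}^\infty E_n,\ \mathrm{diam}\,E_n<\varepsilon\ \forall n\}$ with the conventions $0^0=1$ and $\mathrm{diam}(\emptyset)^s=0$; $\dim_{\mathrm{H}}(\mathcal{X},d,\varepsilon)=\sup\{s\ge0:\mathcal{H}^s_\varepsilon(\mathcal{X},d)\ge1\}$; $\mathrm{mdim}_{\mathrm{H}}(\mathcal{X},T,d)=\lim_{\varepsilon\to0}\big(\limsup_{N\to\infty}\frac1N\dim_{\mathrm{H}}(\mathcal{X},d_N,\varepsilon)\big)$. Mutual information: for finitely-valued $X,Y$, $I(X;Y)=H(X)+H(Y)-H(X,Y)$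 ($H$ is Shannon entropy); in general $I(X;Y)$ is the supremum of $I(\mathcal{P}\circ X;\mathcal{Q}\circ Y)$ over finite measurable partitions $\mathcal{P},\mathcal{Q}$ of the target spaces (where $\mathcal{P}(x)$ is the element of $\mathcal{P}$ containing $x$). Rate distortion: for a $T$-invariant Borel probability measure $\mu$ and $\varepsilon>0$, $R(d,\mu,\varepsilon)$ is the infimum of $I(X;Y)/N$ over all positive integers $N$ and all random variables $X$, $Y=(Y_0,\dots,Y_{N-1})$ defined on some probability space, with $X$ and all $Y_n$ valued in $\mathcal{X}$, $\mathrm{Law}(X)=\mu$ and $\mathbb{E}\big(\frac1N\sum_{n=0}^{N-1}d(T^nX,Y_n)\big)<\varepsilon$. $\overline{\mathrm{rdim}}(\mathcal{X},T,d,\mu)$ and $\underline{\mathrm{rdim}}(\mathcal{X},T,d,\mu)$ are the $\limsup$ and $\liminf$ as $\varepsilon\to0$ of $R(d,\mu,\varepsilon)/\log(1/\varepsilon)$. *)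

(* Defs.v *)
From HB Require Import structures.
From mathcomp Require Import all_boot all_order all_algebra.
From mathcomp Require Import all_classical all_reals all_analysis.

Set Implicit Arguments.
Unset Strict Implicit.
Unset Printing Implicit Defensive.

Import Order.TTheory GRing.Theory Num.Theory.
Import numFieldNormedType.Exports.

Local Open Scope classical_set_scope.
Local Open Scope ring_scope.
Local Open Scope ereal_scope.

Record compatible_metric (R : realType) (X : topologicalType)
    (d : X -> X -> R) : Prop := CompatibleMetric {
  cmetric_eq0 : forall x y, d x y = 0%R <-> x = y;
  cmetric_sym : forall x y, d x y = d y x;
  cmetric_triangle : forall x y z, (d x z <= d x y + d y z)%R;
  cmetric_nbhs : forall x : X, nbhs x =
    filter_from [set e : R | (0 < e)%R] (fun e => [set y | (d x y < e)%R])
}.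

Definition homeomorphism (X Y : topologicalType) (T : X -> Y) : Prop :=
  continuous T /\
  exists S : Y -> X, [/\ cancel T S, cancel S T & continuous S].

(* The default value 0 is neutral since [d] is nonnegative. *)
Definition dyn_metric (R : realType) (X : Type) (T : X -> X)
    (d : X -> X -> R) (N : nat) (x y : X) : R :=
  \big[Num.max/0%R]_(n < N) d (iter n T x) (iter n T y).

(* Adjoining 0 only matters for the empty set, whose diameter is 0. *)
Definition diam (R : realType) (X : Type) (d : X -> X -> R) (A : set X) :
    \bar R :=
  ereal_sup ([set (d x y)%:E | x in A & y in A] `|` [set 0]).

Definition log2 (R : realType) (x : R) : R := (ln x / ln 2)%R.

Definition log2e (R : realType) (x : \bar R) : \bar R :=
  lne x * ((ln 2)^-1)%:E.

(* +oo if [P] is empty *)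
Definition min_nat (R : realType) (P : set nat) : \bar R :=
  ereal_inf [set (n%:R : R)%:E | n in P].

(* A simplex is represented by its (nonempty) set of vertices. *)
Definition simplicial_complex (k : nat) (K : {set {set 'I_k}}) : Prop :=
  forall s, s \in K ->
    s != finset.set0 /\ forall t : {set 'I_k}, t \subset s -> t != finset.set0 -> t \in K.

Definition complex_dim (k : nat) (K : {set {set 'I_k}}) (n : nat) : Prop :=
  (\max_(s in K) #|s|)%N = n.+1.

(* Points are given by their barycentric coordinates. *)
Definition realization (R : realType) (k : nat) (K : {set {set 'I_k}}) :
    set 'rV[R]_k :=
  [set v | [/\ forall i, (0 <= v ord0 i)%R,
               (\sum_i v ord0 i = 1)%R &
               finset (fun i => v ord0 i != 0%R) \in K]].

Definition eps_embedding (R : realType) (X : topologicalType)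
    (d : X -> X -> R) (e : R) (Y : topologicalType) (f : X -> Y) : Prop :=
  continuous f /\ forall y : Y, diam d (f @^-1` [set y]) < e%:E.

Definition widim (R : realType) (X : topologicalType) (d : X -> X -> R)
    (e : R) : \bar R :=
  min_nat R [set n : nat | exists k (K : {set {set 'I_k}}) (f : X -> 'rV[R]_k),
    [/\ simplicial_complex K, complex_dim K n,
        range f `<=` realization K & eps_embedding d e f]].

(* The value is the same for every compatible metric [d]. *)
Definition mdim (R : realType) (X : topologicalType) (T : X -> X)
    (d : X -> X -> R) : \bar R :=
  lim ((fun e : R =>
      lim ((fun N : nat => widim (dyn_metric T d N) e * (N%:R^-1)%:E) @ \oo))
    @ 0^'+).

Definition cov_number (R : realType) (X : topologicalType) (d : X -> X -> R)
    (e : R) : \bar R :=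
  min_nat R [set n : nat | (1 <= n)%N /\ exists U : 'I_n -> set X,
    [/\ forall i, open (U i), \bigcup_i U i = [set: X] &
        forall i, diam d (U i) < e%:E]].

Definition S_entropy (R : realType) (X : topologicalType) (T : X -> X)
    (d : X -> X -> R) (e : R) : \bar R :=
  lim ((fun N : nat => (N%:R^-1)%:E * log2e (cov_number (dyn_metric T d N) e))
    @ \oo).

Definition upper_mdimM (R : realType) (X : topologicalType) (T : X -> X)
    (d : X -> X -> R) : \bar R :=
  limf_esup (fun e : R => S_entropy T d e * ((log2 e^-1)^-1)%:E) 0^'+.

Definition lower_mdimM (R : realType) (X : topologicalType) (T : X -> X)
    (d : X -> X -> R) : \bar R :=
  limf_einf (fun e : R => S_entropy T d e * ((log2 e^-1)^-1)%:E) 0^'+.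

(* [poweR] satisfies 0 `^ 0 = 1. *)
Definition diam_pow (R : realType) (X : Type) (d : X -> X -> R) (s : R)
    (A : set X) : \bar R :=
  if A == set0 then 0 else (diam d A) `^ s.

Definition hausdorff_content (R : realType) (X : Type) (d : X -> X -> R)
    (s e : R) : \bar R :=
  ereal_inf [set \sum_(0 <= n <oo) diam_pow d s (E n) |
    E in [set E : nat -> set X |
      \bigcup_n E n = [set: X] /\ forall n, diam d (E n) < e%:E]].

Definition hausdorff_dim (R : realType) (X : Type) (d : X -> X -> R)
    (e : R) : \bar R :=
  ereal_sup [set s%:E | s in
    [set s : R | (0 <= s)%R /\ 1 <= hausdorff_content d s e]].

Definition mdimH (R : realType) (X : Type) (T : X -> X) (d : X -> X -> R) :
    \bar R :=
  lim ((fun e : R => limn_esup (fun N : nat =>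
      (N%:R^-1)%:E * hausdorff_dim (dyn_metric T d N) e))
    @ 0^'+).

(* Shannon entropy in bits; ln 0 = 0, hence 0 log 0 = 0. *)
Definition shannon (disp : measure_display) (Om : measurableType disp)
    (R : realType) (P : probability Om R) (I : finType) (Z : Om -> I) : R :=
  (- \sum_(i : I) fine (P (Z @^-1` [set i])) *
                  log2 (fine (P (Z @^-1` [set i]))))%R.

Definition mutual_info_fin (disp : measure_display)
    (Om : measurableType disp) (R : realType) (P : probability Om R)
    (I J : finType) (Z : Om -> I) (W : Om -> J) : R :=
  (shannon P Z + shannon P W - shannon P (fun w => (Z w, W w)))%R.

(* A finite measurable partition with labelled cells is encoded by the map
   sending a point to the label of its cell. *)
Definition fin_partition (disp : measure_display) (U : measurableType disp)
    (m : nat) (p : U -> 'I_m) : Prop :=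
  forall i, measurable (p @^-1` [set i]).

Definition mutual_info (disp d1 d2 : measure_display)
    (Om : measurableType disp) (U : measurableType d1) (V : measurableType d2)
    (R : realType) (P : probability Om R) (X : Om -> U) (Y : Om -> V) :
    \bar R :=
  ereal_sup [set r | exists m k (p : U -> 'I_m) (q : V -> 'I_k),
    [/\ fin_partition p, fin_partition q &
        r = (mutual_info_fin P (p \o X) (q \o Y))%:E]].

Notation borel X := (g_sigma_algebraType (@open X)).

Definition invariant_measure (R : realType) (X : ptopologicalType)
    (T : X -> X) (mu : probability (borel X) R) : Prop :=
  forall A : set (borel X), measurable A -> mu (T @^-1` A) = mu A.

Definition rate_distortion (R : realType) (X : ptopologicalType) (T : X -> X)
    (d : X -> X -> R) (mu : probability (borel X) R) (e : R) : \bar R :=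
  ereal_inf [set r | exists (N : nat) (disp : measure_display)
      (Om : measurableType disp) (P : probability Om R)
      (Z : {RV P >-> borel X}) (Y : {RV P >-> N.-tuple (borel X)}),
    [/\ (0 < N)%N,
        forall A : set (borel X), measurable A -> distribution P Z A = mu A,
        'E_P[fun w =>
          (N%:R^-1 * \sum_(n < N) d (iter n T (Z w)) (tnth (Y w) n))%R] < e%:E &
        r = mutual_info P Z Y * (N%:R^-1)%:E]].

Definition upper_rdim (R : realType) (X : ptopologicalType) (T : X -> X)
    (d : X -> X -> R) (mu : probability (borel X) R) : \bar R :=
  limf_esup (fun e : R => rate_distortion T d mu e * ((log2 e^-1)^-1)%:E) 0^'+.

Definition lower_rdim (R : realType) (X : ptopologicalType) (T : X -> X)
    (d : X -> X -> R) (mu : probability (borel X) R) : \bar R :=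
  limf_einf (fun e : R => rate_distortion T d mu e * ((log2 e^-1)^-1)%:E) 0^'+.

(* Main.v *)
Require Import Defs.
From HB Require Import structures.
From mathcomp Require Import all_boot all_order all_algebra.
From mathcomp Require Import all_classical all_reals all_analysis.
From mathcomp Require Import finmap ring lra.

(** The second inequality and the two rate distortion inequalities come from
    efficient covers. Let [n] be the least number of open sets of
    [dyn_metric T d N]-diameter less than [e] that cover the space. Such a cover
    has [s]-dimensional content at most [n * e ^ s], so the Hausdorff dimension
    at any scale above [e] is at most [log n / log (1 / e)]
    ([hausdorff_dim_le]). It also quantizes the invariant measure: send a point
    to the orbit segment of a representative of its cell. The distortion is less
    than [e], and the mutual information is at most [log n], because the
    quantized variable takes at most [n] values ([mutual_info_fin_le],
    [rate_distortion_le]). Dividing by [N] and letting [N] grow replaces [log n]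
    by [S_entropy]; this needs [log n / N] to converge, which is Fekete's lemma
    for the submultiplicative covering numbers ([S_entropy_cvg]).

    The first inequality bounds the dimension of a simplicial complex by the
    Hausdorff dimension. Finitely many Lipschitz cutoffs on the space, composed
    with the first [N] iterates of [T], give a Lipschitz map [h] to a cube
    [0, 1]^I such that two points at distance more than [e / 2] are at opposite
    ends of some coordinate. A set of small [s]-dimensional content with
    [s < k + 1] has negligible projections to the faces of dimension [k + 1], so
    for a generic point [c] of the cube no point of the space has more than [k]
    coordinates close to those of [c]. Here this is a count over a finite grid:
    [c] is a choice of one grid cell per coordinate, and a Chernoff bound over
    all choices does the work of Lebesgue measure ([exists_sparse_choice],
    [widim_le_of_content]). Stretching the chosen cell of each coordinate to
    [0, 1] then gives a map into the [k]-skeleton of the cube that still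
    separates points at distance more than [e / 2], and triangulating the cube
    by chains of subsets of [I] turns it into an [e]-embedding into a complex of
    dimension at most [k] ([widim_le]). With [N] iterates the number of
    coordinates and all exponents grow linearly in [N], so a small enough scale,
    independent of [N], makes the count succeed for [k] about [D * N], as soon
    as [D] exceeds the mean Hausdorff dimension ([widim_dyn_le]). *)

Set Implicit Arguments.
Unset Strict Implicit.
Unset Printing Implicit Defensive.

Import Order.TTheory GRing.Theory Num.Theory.
Import numFieldNormedType.Exports.

Local Open Scope classical_set_scope.
Local Open Scope ring_scope.
Local Open Scope ereal_scope.

(** * Limits, limits superior and Fekete's lemma *)

(** A filter without a limit is assigned the point 0 of the extended reals,
    so a nonnegative eventual bound passes to [lim] whether or not the limit
    exists. *)
Lemma lim_le_near {R : realType} {I : Type} {F : set_system I}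
    {FF : ProperFilter F} (f : I -> \bar R) (B : \bar R) :
  0 <= B -> (\forall x \near F, f x <= B) -> lim (f @ F) <= B.
Proof.
move=> B0 fB; have [cf|ncf] := pselect (cvg (f @ F)); first exact: lime_le.
by rewrite dvgP.
Qed.

Lemma limf_esup_lt {R : realType} {I : choiceType} {X : filteredType I}
    (F : set_system X) {FF : Filter F} (f : X -> \bar R) (c : \bar R) :
  limf_esup f F < c -> \forall x \near F, f x < c.
Proof.
move=> /ereal_inf_lt[_ [V FV <-]] Vc; apply: filterS FV => x Vx.
by apply: le_lt_trans Vc; apply: ereal_sup_ubound; exists x.
Qed.

Lemma limf_esup_le_near {R : realType} {I : choiceType} {X : filteredType I}
    (F : set_system X) {FF : Filter F} (f g : X -> \bar R) :
  (\forall x \near F, f x <= g x) -> limf_esup f F <= limf_esup g F.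
Proof.
move=> fg; apply: le_ereal_inf_tmp => _ [V FV <-].
apply: ge_ereal_inf; exists (ereal_sup (f @` (V `&` [set x | f x <= g x]))).
  by exists (V `&` [set x | f x <= g x]) => //; exact: filterI.
apply: ge_ereal_sup => _ [x [Vx fgx] <-]; apply: (le_trans fgx).
by apply: ereal_sup_ubound; exists x.
Qed.

Lemma limf_einf_le_near {R : realType} {I : choiceType} {X : filteredType I}
    (F : set_system X) {FF : Filter F} (f g : X -> \bar R) :
  (\forall x \near F, f x <= g x) -> limf_einf f F <= limf_einf g F.
Proof.
move=> fg; rewrite /limf_einf leeN2; apply: limf_esup_le_near.
by apply: filterS fg => x; rewrite leeN2.
Qed.

Lemma limf_einf_ge_near {R : realType} {I : choiceType} {X : filteredType I}
    (F : set_system X) (f : X -> \bar R) (c : \bar R) :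
  (\forall x \near F, c <= f x) -> c <= limf_einf f F.
Proof.
move=> cf; rewrite limf_einfE; apply: le_ereal_sup_tmp.
exists (ereal_inf (f @` [set x | c <= f x])); first by exists [set x | c <= f x].
by apply: le_ereal_inf_tmp => _ [x cx <-].
Qed.

(** Fekete's lemma: with [n = q m + r] and [r < m], subadditivity bounds
    [a n / n] by [a m / m] up to an error that is a constant over [n]; hence
    the averages converge to their infimum. *)
Lemma fekete {R : realType} (a : nat -> R) :
  (forall n, 0 <= a n)%R -> (forall m n, a (m + n)%N <= a m + a n)%R ->
  cvgn (fun n => n%:R^-1 * a n)%R.
Proof.
move=> a0 asub.
pose b n := (n%:R^-1 * a n)%R.
pose A := [set b n | n in [set n | (0 < n)%N]].
have b0 n : (0 <= b n)%R by rewrite mulr_ge0 ?invr_ge0.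
have hA : has_inf A.
  split; first by exists (b 1%N), 1%N.
  by exists 0%R => _ [n _ <-].
apply/cvg_ex; exists (inf A); apply/cvgrPdist_le => /= e e0.
have [_ [m m0 <-]] := inf_adherent (divr_gt0 e0 (ltr0n R 2)) hA => bm.
pose C := (\sum_(r < m) a r)%R.
have aC r : (r < m)%N -> (a r <= C)%R.
  move=> rm; rewrite /C (bigD1 (Ordinal rm)) //= lerDl.
  by apply: sumr_ge0 => i _.
have aq q r : (a (q * m + r)%N <= q%:R * a m + a r)%R.
  elim: q => [|q IH]; first by rewrite mul0n add0n mul0r add0r.
  rewrite mulSn -addnA; apply: (le_trans (asub _ _)).
  by rewrite -natr1 mulrDl mul1r; move: IH; lra.
have C0 : (0 <= C)%R by apply: sumr_ge0 => i _.
near=> n.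
have n0 : (0 < n)%N by near: n; exact: nbhs_infty_gt.
have nR : (0 < n%:R :> R)%R by rewrite ltr0n.
have infb : (inf A <= b n)%R by apply: ge_inf; [exact: hA.2|exists n].
have Cn : (C / n%:R <= e / 2)%R.
  have : (C / (e / 2) <= n%:R)%R.
    near: n; exact: nbhs_infty_ger.
  rewrite ler_pdivrMr ?divr_gt0// => h.
  by rewrite ler_pdivrMr// mulrC.
have bn : (b n <= b m + C / n%:R)%R.
  have := aq (n %/ m)%N (n %% m)%N; rewrite -divn_eq => h.
  have h2 : (a n <= (n %/ m)%:R * a m + C)%R.
    by apply: (le_trans h); rewrite lerD2l aC// ltn_mod.
  have qm : ((n %/ m)%:R <= n%:R / m%:R :> R)%R.
    by rewrite ler_pdivlMr ?ltr0n// -natrM ler_nat leq_trunc_div.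
  rewrite /b [X in (_ <= X)%R](_ : _ = n%:R^-1 * (n%:R / m%:R * a m + C))%R.
    rewrite ler_wpM2l ?invr_ge0//; apply: (le_trans h2).
    by rewrite lerD2r ler_wpM2r.
  by rewrite mulrDr !mulrA mulVf ?gt_eqF// mul1r [(C / _)%R]mulrC.
rewrite ler_norml; move: bm; rewrite -/(b n); lra.
Unshelve. all: by end_near. Qed.

(** * Minima of sets of natural numbers *)

Lemma min_nat_le {R : realType} (P : set nat) (n : nat) :
  P n -> min_nat R P <= n%:R%:E.
Proof. by move=> Pn; apply: ereal_inf_lbound; exists n. Qed.

Lemma min_nat_attained {R : realType} {P : set nat} {n : nat} :
  P n -> exists2 m, P m & min_nat R P = m%:R%:E.
Proof.
move=> Pn; have exP : exists k, `[< P k >] by exists n; apply/asboolP.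

case: (ex_minnP exP) => m /asboolP Pm mmin; exists m => //.
apply/eqP; rewrite eq_le min_nat_le//=.
apply: le_ereal_inf_tmp => _ [k Pk <-]; rewrite lee_fin ler_nat mmin//.
exact/asboolP.
Qed.

(** * Continuous pseudometrics, diameters and dynamical metrics *)

(** The metrics [dyn_metric T d N] are compatible with the topology only for
    positive [N]; what the arguments below use of them is shared by all [N]. *)
Record continuous_pseudometric {R : realType} {X : topologicalType}
    (d : X -> X -> R) : Prop := ContinuousPseudometric {
  cpm_refl : forall x, d x x = 0%R;
  cpm_sym : forall x y, d x y = d y x;
  cpm_triangle : forall x y z, (d x z <= d x y + d y z)%R;
  cpm_nbhs : forall (x : X) (e : R), (0 < e)%R ->
    nbhs x [set y | (d x y < e)%R]
}.

Lemma compatible_metric_continuous {R : realType} {X : topologicalType}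
    (d : X -> X -> R) : compatible_metric d -> continuous_pseudometric d.
Proof.
move=> [d0 ds dt dn]; split => // [x|x e e0]; first exact/d0.
by rewrite dn; exists e.
Qed.

Lemma cpm_ge0 {R : realType} {X : topologicalType} {d : X -> X -> R} :
  continuous_pseudometric d -> forall x y, (0 <= d x y)%R.
Proof.
move=> [d0 ds dt _] x y; have := dt x y x.
by rewrite d0 (ds y x); lra.
Qed.

Lemma cpm_ball_open {R : realType} {X : topologicalType} {d : X -> X -> R}
    (hd : continuous_pseudometric d) (p : X) (e : R) :
  open [set x | (d p x < e)%R].
Proof.
rewrite openE => x /= dpx; have e0 : (0 < e - d p x)%R by rewrite subr_gt0.
apply: filterS (cpm_nbhs hd x e0) => y /= dxy.
by have := cpm_triangle hd p x y; lra.
Qed.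

Lemma diam_ge0 {R : realType} {X : Type} (d : X -> X -> R) (A : set X) :
  0 <= diam d A.
Proof. by apply: ereal_sup_ubound; right. Qed.

Lemma le_diam {R : realType} {X : Type} (d : X -> X -> R) (A : set X) (x y : X) :
  A x -> A y -> (d x y)%:E <= diam d A.
Proof. by move=> Ax Ay; apply: ereal_sup_ubound; left; exists x => //; exists y. Qed.

Lemma diam_le {R : realType} {X : Type} (d : X -> X -> R) (A : set X) (c : R) :
  (0 <= c)%R -> (forall x y, A x -> A y -> d x y <= c)%R -> diam d A <= c%:E.
Proof.
move=> c0 dc; apply: ge_ereal_sup => _ [[x Ax [y Ay <-]]|->]; rewrite lee_fin//.
exact: dc.
Qed.

Lemma diam_fin_num {R : realType} {X : Type} (d : X -> X -> R) (A : set X)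
    (e : R) : diam d A < e%:E -> diam d A \is a fin_num.
Proof.
move=> de; rewrite ge0_fin_numE ?diam_ge0//.
by apply: lt_trans de _; rewrite ltry.
Qed.

Lemma diam_set0 {R : realType} {X : Type} (d : X -> X -> R) : diam d set0 = 0.
Proof. by apply/eqP; rewrite eq_le diam_ge0 diam_le. Qed.

Lemma dyn_metric_le {R : realType} {X : Type} (T : X -> X) (d : X -> X -> R)
    (N : nat) (x y : X) (c : R) : (0 <= c)%R ->
  (dyn_metric T d N x y <= c)%R <->
  (forall n, (n < N)%N -> d (iter n T x) (iter n T y) <= c)%R.
Proof.
move=> c0; split.
  by move=> /bigmax_leP[_ h] n nN; exact: (h (Ordinal nN)).
by move=> h; apply/bigmax_leP; split => // i _; exact: h.
Qed.

Lemma dyn_metric_lt {R : realType} {X : Type} (T : X -> X) (d : X -> X -> R)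
    (N : nat) (x y : X) (c : R) : (0 < c)%R ->
  (dyn_metric T d N x y < c)%R <->
  (forall n, (n < N)%N -> d (iter n T x) (iter n T y) < c)%R.
Proof.
move=> c0; split.
  by move=> /bigmax_ltP[_ h] n nN; exact: (h (Ordinal nN)).
by move=> h; apply/bigmax_ltP; split => // i _; exact: h.
Qed.

Lemma dist_le_dyn_metric {R : realType} {X : Type} (T : X -> X)
    (d : X -> X -> R) (N n : nat) (x y : X) : (n < N)%N ->
  (d (iter n T x) (iter n T y) <= dyn_metric T d N x y)%R.
Proof. by move=> nN; rewrite /dyn_metric (bigD1 (Ordinal nN)) //= le_max lexx. Qed.

Lemma dyn_metric_ge0 {R : realType} {X : Type} (T : X -> X) (d : X -> X -> R)
    (N : nat) (x y : X) : (0 <= dyn_metric T d N x y)%R.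
Proof. by apply: bigmax_ge_id. Qed.

Lemma iter_continuous {X : topologicalType} (T : X -> X) (n : nat) :
  continuous T -> continuous (iter n T).
Proof.
move=> cT; elim: n => [|n IH] x /=; first exact: cvg_id.
by apply: continuous_comp; [exact: IH|exact: cT].
Qed.

Lemma dyn_metric_continuous {R : realType} {X : topologicalType} {T : X -> X}
    {d : X -> X -> R} (N : nat) : continuous T -> continuous_pseudometric d ->
  continuous_pseudometric (dyn_metric T d N).
Proof.
move=> cT hd; split=> [x|x y|x y z|x e e0].
- apply/eqP; rewrite eq_le dyn_metric_ge0 andbT.
  by apply/dyn_metric_le => // n _; rewrite cpm_refl.
- by apply: eq_bigr => n _; rewrite (cpm_sym hd).
- apply/dyn_metric_le => [|n nN]; first by rewrite addr_ge0 ?dyn_metric_ge0.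
  by apply: le_trans (cpm_triangle hd _ (iter n T y) _) _;
    apply: lerD; exact: dist_le_dyn_metric.
- have : \forall y \near x, forall n : 'I_N,
      (d (iter n T x) (iter n T y) < e)%R.
    apply: filter_forall => n.
    exact: (@iter_continuous _ _ n cT x _ (cpm_nbhs hd (iter n T x) e0)).
  apply: filterS => y h /=; apply/dyn_metric_lt => // n nN.
  exact: (h (Ordinal nN)).
Qed.

(** Orbit segments of length [m + n] are concatenations of orbit segments of
    lengths [m] and [n]. *)
Lemma dyn_metricD {R : realType} {X : Type} (T : X -> X) (d : X -> X -> R)
    (m n : nat) (x y : X) : dyn_metric T d (m + n) x y =
  Num.max (dyn_metric T d m x y) (dyn_metric T d n (iter m T x) (iter m T y)).
Proof.
apply/eqP; rewrite eq_le; apply/andP; split.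
  apply/dyn_metric_le => [|k]; first by rewrite le_max dyn_metric_ge0.
  rewrite le_max; have [km _|mk kmn] := ltnP k m.
    by rewrite dist_le_dyn_metric.
  apply/orP; right; rewrite -(subnK mk) !iterD.
  by apply: dist_le_dyn_metric; rewrite ltn_subLR.
rewrite ge_max; apply/andP; split; apply/dyn_metric_le;
  rewrite ?dyn_metric_ge0// => k kn.
  by apply: dist_le_dyn_metric; rewrite (leq_trans kn)// leq_addr.
by rewrite -!iterD addnC; apply: dist_le_dyn_metric; rewrite ltn_add2l.
Qed.

(** * Covering numbers and their exponential growth rate *)

Lemma compact_finite_cover {X : ptopologicalType} {I : choiceType}
    (U : I -> set X) : compact [set: X] -> (forall i, open (U i)) ->
  \bigcup_i U i = [set: X] ->
  exists n (f : 'I_n -> I), \bigcup_k U (f k) = [set: X].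
Proof.
rewrite compact_cover => cX oU cU.
have [D _ cD] : finite_subset_cover [set: I] U [set: X].
  apply: cX => [i _|x _]; first exact: oU.
  by have : (\bigcup_i U i) x by rewrite cU.
exists (size (enum_fset D)), (tnth (in_tuple (enum_fset D))).
apply/seteqP; split=> // x _; have [i /= iD Ux] := cD x Logic.I.
have /tnthP[k kE] : i \in in_tuple (enum_fset D) by [].
by exists k => //; rewrite -kE.
Qed.

Lemma finite_cover_diam {R : realType} {X : ptopologicalType}
    (d : X -> X -> R) (e : R) : compact [set: X] ->
  continuous_pseudometric d -> (0 < e)%R ->
  exists n (U : 'I_n -> set X), [/\ forall i, open (U i),
    \bigcup_i U i = [set: X] & forall i, diam d (U i) < e%:E].
Proof.
move=> cX hd e0; have e3 : (0 < e / 3)%R by rewrite divr_gt0.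
have [||n [f fc]] := @compact_finite_cover X X
  (fun p => [set x | (d p x < e / 3)%R]) cX.
- by move=> p; exact: cpm_ball_open.
- by apply/seteqP; split => // x _; exists x => //=; rewrite (cpm_refl hd).
exists n, (fun k => [set x | (d (f k) x < e / 3)%R]); split => // [k|k].
  exact: cpm_ball_open.
apply: (@le_lt_trans _ _ (e / 3 + e / 3)%:E); last by rewrite lte_fin; lra.
apply: diam_le => [|x y /= dx dy]; first by rewrite addr_ge0// ltW.
apply: le_trans (cpm_triangle hd x (f k) y) _.
by rewrite (cpm_sym hd x); apply: lerD; exact: ltW.
Qed.

Lemma cov_number_le_card {R : realType} {X : ptopologicalType}
    (d : X -> X -> R) (e : R) (I : finType) (U : I -> set X) :
  (forall i, open (U i)) -> \bigcup_i U i = [set: X] ->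
  (forall i, diam d (U i) < e%:E) -> cov_number d e <= #|I|%:R%:E.
Proof.
move=> oU cU dU; apply: min_nat_le; split.
  have [i _ _] : (\bigcup_i U i) point by rewrite cU.
  by apply/card_gt0P; exists i.
exists (U \o enum_val); split => //=.
rewrite -cU; apply/seteqP; split=> x [i _ Ux]; first by exists (enum_val i).
by exists (enum_rank i) => //=; rewrite enum_rankK.
Qed.

Lemma cov_number_attained {R : realType} {X : ptopologicalType}
    (d : X -> X -> R) (e : R) : compact [set: X] ->
  continuous_pseudometric d -> (0 < e)%R ->
  exists n (U : 'I_n -> set X), [/\ (1 <= n)%N, cov_number d e = n%:R%:E,
    forall i, open (U i), \bigcup_i U i = [set: X] &
    forall i, diam d (U i) < e%:E].
Proof.
move=> cX hd e0; have [n [U [oU cU dU]]] := finite_cover_diam cX hd e0.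
pose P := [set n : nat | (1 <= n)%N /\ exists U : 'I_n -> set X,
    [/\ forall i, open (U i), \bigcup_i U i = [set: X] &
        forall i, diam d (U i) < e%:E]].
have Pn : P n.
  split; last by exists U.
  by have [i _ _] : (\bigcup_i U i) point by [rewrite cU]; case: (n) i => // -[].
have [m [m1 [V [oV cV dV]]] mE] := @min_nat_attained R P n Pn.
by exists m, V.
Qed.

Lemma log2e_nat {R : realType} (n : nat) : (1 <= n)%N ->
  log2e (n%:R%:E : \bar R) = (log2 n%:R)%:E.
Proof. by move=> n1; rewrite /log2e lne_EFin ?ltr0n// -EFinM. Qed.

Lemma log2_ge0 {R : realType} (x : R) : (1 <= x)%R -> (0 <= log2 x)%R.
Proof. by move=> x1; rewrite divr_ge0 ?ln_ge0// ler1n. Qed.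

Lemma ler_log2 {R : realType} (x y : R) : (0 < x)%R -> (x <= y)%R ->
  (log2 x <= log2 y)%R.
Proof.
move=> x0 xy; rewrite ler_wpM2r ?invr_ge0 ?ln_ge0 ?ler1n//.
by rewrite ler_ln// posrE// (lt_le_trans x0).
Qed.

Lemma log2M {R : realType} (x y : R) : (0 < x)%R -> (0 < y)%R ->
  log2 (x * y) = (log2 x + log2 y)%R.
Proof. by move=> x0 y0; rewrite /log2 lnM ?posrE// mulrDl. Qed.

Lemma log2_gt0 {R : realType} (x : R) : (1 < x)%R -> (0 < log2 x)%R.
Proof. by move=> x1; rewrite divr_gt0 ?ln_gt0// ltr1n. Qed.

(** Intersecting a cover for the first [m] steps with the pullback by [T^m] of
    a cover for [n] steps shows that covering numbers are submultiplicative;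
    Fekete's lemma then applies to their logarithms. *)
Lemma S_entropy_cvg {R : realType} {X : ptopologicalType} (T : X -> X)
    (d : X -> X -> R) (e : R) : compact [set: X] -> continuous T ->
  continuous_pseudometric d -> (0 < e)%R ->
  (fun N : nat => (N%:R^-1)%:E * log2e (cov_number (dyn_metric T d N) e)) @ \oo
    --> S_entropy T d e.
Proof.
move=> cX cT hd e0.
have covP N := cov_number_attained cX (dyn_metric_continuous N cT hd) e0.
pose c N : R := fine (cov_number (dyn_metric T d N) e).
have c1 N : (1 <= c N)%R.
  by have [n [_ [n1 cn _ _ _]]] := covP N; rewrite /c cn ler1n.
have logc N : log2e (cov_number (dyn_metric T d N) e) = (log2 (c N))%:E.
  by have [n [_ [n1 cn _ _ _]]] := covP N; rewrite /c cn log2e_nat.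
have cM m n : (c (m + n)%N <= c m * c n)%R.
  have [km [U [_ cm oU cU dU]]] := covP m.
  have [kn [V [_ cn oV cV dV]]] := covP n.
  have [kmn [_ [_ cmn _ _ _]]] := covP (m + n)%N.
  suff : cov_number (dyn_metric T d (m + n)) e <= (km * kn)%:R%:E.
    by rewrite /c cm cn cmn /= lee_fin natrM.
  rewrite (_ : (km * kn)%N = #|{: 'I_km * 'I_kn}|); last first.
    by rewrite card_prod !card_ord.
  apply: (@cov_number_le_card _ _ _ _ _
    (fun ij => U ij.1 `&` (iter m T) @^-1` (V ij.2))).
  - move=> ij; apply: openI => //.
    by apply: open_comp => // x _; exact: iter_continuous.
  - apply/seteqP; split => // x _.
    have [i _ Ui] : (\bigcup_i U i) x by rewrite cU.
    have [j _ Vj] : (\bigcup_i V i) (iter m T x) by rewrite cV.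
    by exists (i, j).
  - move=> [i j] /=.
    apply: (@le_lt_trans _ _ (Num.max (fine (diam (dyn_metric T d m) (U i)))
      (fine (diam (dyn_metric T d n) (V j))))%:E).
      apply: diam_le => [|x y [/= Ux Vx] [/= Uy Vy]].
        by rewrite le_max fine_ge0 ?diam_ge0.
      rewrite dyn_metricD ge_max !le_max -!lee_fin.
      rewrite (fineK (diam_fin_num (dU i))) (fineK (diam_fin_num (dV j))).
      by rewrite le_diam//= le_diam// orbT.
    rewrite EFin_max gt_max.
    rewrite (fineK (diam_fin_num (dU i))) (fineK (diam_fin_num (dV j))).
    by rewrite dU dV.
have cpos N : (0 < c N)%R by exact: lt_le_trans (c1 N).
have := @fekete R (fun N => log2 (c N)) (fun N => log2_ge0 (c1 N)).
move=> /(_ _)/cvg_ex[|/= l al].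
  by move=> m n; rewrite -log2M//; apply: ler_log2.
suff ul : (fun N : nat => (N%:R^-1)%:E *
    log2e (cov_number (dyn_metric T d N) e)) @ \oo --> l%:E.
  by rewrite /S_entropy (cvg_lim _ ul).
under eq_fun do rewrite logc -EFinM.
by apply: cvg_EFin => /=; first exact: nearW.
Qed.

(** * Mean Hausdorff dimension and metric mean dimension *)

(** A cover by [n] sets of diameter less than [e] bounds the [s]-dimensional
    content by [n * e ^ s], which is less than 1 once [s] exceeds
    [log n / log (1 / e)]. *)
Lemma hausdorff_dim_le {R : realType} {X : Type} (d : X -> X -> R)
    (n : nat) (U : 'I_n -> set X) (e delta : R) :
  (0 < n)%N -> (0 < e)%R -> (e < 1)%R -> (e <= delta)%R ->
  \bigcup_i U i = [set: X] -> (forall i, diam d (U i) < e%:E) ->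
  hausdorff_dim d delta <= (log2 n%:R / log2 e^-1)%:E.
Proof.
move=> n0 e0 e1 ed cU dU; apply: ge_ereal_sup => _ [s [s0 Hs] <-].
rewrite lee_fin.
pose E k := if insub k is Some i then U i else set0.
have dE k : diam d (E k) < e%:E.
  by rewrite /E; case: insubP => [i _ _|_] //; rewrite diam_set0 lte_fin.
have pE k : diam_pow d s (E k) <= (e `^ s)%:E.
  rewrite /diam_pow; case: ifPn => _; first by rewrite lee_fin powR_ge0.
  rewrite -(fineK (diam_fin_num (dE k))) poweR_EFin lee_fin.
  rewrite ge0_ler_powR ?nnegrE ?fine_ge0 ?diam_ge0 ?(ltW e0)//.
  by rewrite -lee_fin (fineK (diam_fin_num (dE k))) ltW.
have sE : \sum_(0 <= k <oo) diam_pow d s (E k) <= (n%:R * e `^ s)%:E.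
  apply: lime_le.
    apply: is_cvg_nneseries => k _ _; rewrite /diam_pow; case: ifPn => // _.
    exact: poweR_ge0.
  exists n => // m /= nm; rewrite (@big_cat_nat _ _ _ n)//=.
  rewrite [X in _ + X]big1_seq ?adde0; last first.
    move=> k /andP[_]; rewrite mem_index_iota => /andP[nk _].
    by rewrite /E insubN ?ltnNge ?nk// /diam_pow eqxx.
  apply: (@le_trans _ _ (\sum_(0 <= k < n) (e `^ s)%:E)).
    by apply: lee_sum => k _; exact: pE.
  by rewrite sumEFin lee_fin sumr_const_nat subn0 mulr_natl.
have ens : (1 <= n%:R * e `^ s)%R.
  rewrite -lee_fin; apply: (le_trans Hs); apply: ge_ereal_inf.
  exists (\sum_(0 <= k <oo) diam_pow d s (E k)) => //; exists E => //; split.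
    apply/seteqP; split => // x _.
    have [i _ Ui] : (\bigcup_i U i) x by rewrite cU.
    by exists (val i) => //; rewrite /E valK.
  by move=> k; apply: lt_le_trans (dE k) _; rewrite lee_fin.
have : (0 <= log2 (n%:R * e `^ s))%R by exact: log2_ge0.
have le0 : (0 < log2 e^-1)%R by rewrite log2_gt0// invf_gt1.
rewrite log2M ?ltr0n ?powR_gt0// ler_pdivlMr// /log2 ln_powR.
rewrite lnV ?posrE//; lra.
Qed.

Lemma limsup_hausdorff_dim_le {R : realType} {X : ptopologicalType}
    (T : X -> X) (d : X -> X -> R) (e delta : R) : compact [set: X] ->
  continuous T -> continuous_pseudometric d ->
  (0 < e)%R -> (e < 1)%R -> (e <= delta)%R ->
  limn_esup (fun N : nat =>
    (N%:R^-1)%:E * hausdorff_dim (dyn_metric T d N) delta) <=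
  S_entropy T d e * ((log2 e^-1)^-1)%:E.
Proof.
move=> cX cT hd e0 e1 ed.
have vS : (fun N : nat => (N%:R^-1)%:E *
    log2e (cov_number (dyn_metric T d N) e) * ((log2 e^-1)^-1)%:E) @ \oo -->
    S_entropy T d e * ((log2 e^-1)^-1)%:E.
  by apply: cvgeZr => //; exact: S_entropy_cvg.
rewrite -(cvg_lim _ vS)// -is_cvg_limn_esupE; last by apply/cvg_ex; eexists; exact: vS.
apply: limf_esup_le_near; near=> N.
have [n [U [n1 cn _ cU dU]]] :=
  cov_number_attained cX (dyn_metric_continuous N cT hd) e0.
rewrite cn log2e_nat// -muleA; apply: lee_wpmul2l; first by rewrite lee_fin invr_ge0.
rewrite -EFinM; exact: hausdorff_dim_le cU dU.
Unshelve. all: by end_near. Qed.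

Lemma S_entropy_ge0 {R : realType} {X : ptopologicalType} (T : X -> X)
    (d : X -> X -> R) (e : R) : compact [set: X] -> continuous T ->
  continuous_pseudometric d -> (0 < e)%R -> 0 <= S_entropy T d e.
Proof.
move=> cX cT hd e0.
have uS := S_entropy_cvg cX cT hd e0.
rewrite -(cvg_lim _ uS)//; apply: lime_ge; first by apply/cvg_ex; eexists; exact: uS.
near=> N; have [n [U [n1 cn _ cU dU]]] :=
  cov_number_attained cX (dyn_metric_continuous N cT hd) e0.
by rewrite cn log2e_nat// -EFinM lee_fin mulr_ge0 ?invr_ge0 ?log2_ge0 ?ler1n.
Unshelve. all: by end_near. Qed.

Lemma near_right0 {R : realType} (b : R) (P : R -> Prop) : (0 < b)%R ->
  (forall e, (0 < e)%R -> (e < b)%R -> P e) -> \forall e \near 0^'+, P e.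
Proof.
move=> b0 hP; near=> e; apply: hP; first by near: e; exact: nbhs_right_gt.
by near: e; exact: nbhs_right_lt.
Unshelve. all: by end_near. Qed.

Lemma mdimH_le_lower_mdimM {R : realType} {X : ptopologicalType} (T : X -> X)
    (d : X -> X -> R) : compact [set: X] -> continuous T ->
  continuous_pseudometric d -> mdimH T d <= lower_mdimM T d.
Proof.
move=> cX cT hd; apply: lim_le_near.
  apply: limf_einf_ge_near; apply: (@near_right0 _ 1) => // e e0 e1.
  rewrite mule_ge0 ?S_entropy_ge0// lee_fin invr_ge0 log2_ge0//.
  by rewrite ltW// invf_gt1.
apply: (@near_right0 _ 1) => // delta delta0 _.
apply: limf_einf_ge_near; apply: (@near_right0 R (Num.min delta 1%R : R)).
  by rewrite lt_min delta0 ltr01.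
move=> e e0; rewrite lt_min => /andP[ed e1].
by apply: limsup_hausdorff_dim_le => //; exact: ltW.
Qed.

(** * Mutual information with a finitely-valued variable *)

(** Each summand [p * ln (p / (a * b))] of the mutual information is bounded by
    the tangent line [ln z <= ln n + z / n - 1], chosen at [z = n] because this
    is the ratio attained when the second variable is uniform on [n] values and
    determined by the first. *)
Lemma joint_entropy_bound {R : realType} (I J : finType) (p : I -> J -> R)
    (a : I -> R) (b : J -> R) (A : {set J}) (n : nat) :
  (0 < n)%N -> (#|A| <= n)%N ->
  (forall i j, 0 <= p i j)%R -> (\sum_i \sum_j p i j = 1)%R ->
  (forall i, a i = \sum_j p i j)%R -> (forall j, b j = \sum_i p i j)%R ->
  (forall i j, j \notin A -> p i j = 0%R) ->
  (\sum_i \sum_j p i j * ln (p i j) - \sum_i a i * ln (a i)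
    - \sum_j b j * ln (b j) <= ln n%:R)%R.
Proof.
move=> n0 An p0 p1 aE bE pA.
have nR : (0 < n%:R :> R)%R by rewrite ltr0n.
have pa i j : (p i j <= a i)%R.
  by rewrite aE (bigD1 j)//= lerDl sumr_ge0.
have pb i j : (p i j <= b j)%R.
  by rewrite bE (bigD1 i)//= lerDl sumr_ge0.
have -> : (\sum_i a i * ln (a i) = \sum_i \sum_j p i j * ln (a i))%R.
  by apply: eq_bigr => i _; rewrite aE mulr_suml.
have -> : (\sum_j b j * ln (b j) = \sum_i \sum_j p i j * ln (b j))%R.
  by rewrite exchange_big; apply: eq_bigr => j _; rewrite bE mulr_suml.
rewrite -!sumrB.
have term i j : (p i j * ln (p i j) - p i j * ln (a i) - p i j * ln (b j) <=
    p i j * (ln n%:R - 1) + p i j / b j / n%:R)%R.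
  have [->|pn0] := eqVneq (p i j) 0%R; first by rewrite !mul0r !subr0 addr0.
  have pp : (0 < p i j)%R by rewrite lt_neqAle eq_sym pn0 p0.
  have ap : (0 < a i)%R := lt_le_trans pp (pa i j).
  have bp : (0 < b j)%R := lt_le_trans pp (pb i j).
  pose z := (p i j / (a i * b j * n%:R))%R.
  have zp : (0 < z)%R by rewrite divr_gt0 ?mulr_gt0.
  have lnz : (ln z <= z - 1)%R.
    by have := @le_ln1Dx R (z - 1)%R; rewrite [(1 + _)%R]addrC subrK; apply; lra.
  have lnzE : ln z = (ln (p i j) - ln (a i) - ln (b j) - ln n%:R)%R.
    by rewrite ln_div ?posrE ?mulr_gt0// !lnM ?posrE ?mulr_gt0//; ring.
  have pz : (p i j * z <= p i j / b j / n%:R)%R.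
    rewrite /z -!mulrA ler_pM2l//.
    rewrite [leRHS](_ : _ = a i / (a i * (b j * n%:R)))%R; last first.
      by field; rewrite !gt_eqF.
    by rewrite ler_pM2r ?pa// invr_gt0 !mulr_gt0.
  have := ler_wpM2l (ltW pp) lnz; rewrite lnzE; move: pz.
  set P := p i j; set Q := (P / b j / n%:R)%R.
  rewrite !mulrBr mulr1; lra.
under eq_bigr do rewrite -!sumrB.
apply: (@le_trans _ _ (\sum_i \sum_j (p i j * (ln n%:R - 1) + p i j / b j / n%:R))%R).
  by apply: ler_sum => i _; apply: ler_sum => j _; exact: term.
under eq_bigr do rewrite big_split/= -mulr_suml.
rewrite big_split/= -mulr_suml p1 mul1r.
suff : (\sum_i \sum_j p i j / b j / n%:R <= 1 :> R)%R by lra.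
rewrite exchange_big/=.
apply: (@le_trans _ _ (\sum_(j in A) n%:R^-1)%R); last first.
  rewrite sumr_const -[X in (X <= _)%R]mulr_natr mulrC ler_pdivrMr// mul1r.
  by rewrite ler_nat.
rewrite [leRHS]big_mkcond/=; apply: ler_sum => j _.
rewrite -!mulr_suml -bE; case: ifPn => [_|jA].
  have [->|bj] := eqVneq (b j) 0%R; first by rewrite !mul0r invr_ge0.
  by rewrite divff// mul1r.
by rewrite bE big1 ?mul0r// => i _; rewrite pA.
Qed.

Lemma prob_sum_cells {disp} {Om : measurableType disp} {R : realType}
    (P : probability Om R) (J : finType) (W : Om -> J) (B : set Om) :
  measurable B -> (forall j, measurable (W @^-1` [set j])) ->
  fine (P B) = (\sum_j fine (P (B `&` W @^-1` [set j])))%R.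
Proof.
move=> mB mW.
have mBW j : measurable (B `&` W @^-1` [set j]) by exact: measurableI.
have PB : P B = \sum_j P (B `&` W @^-1` [set j]).
  rewrite -[LHS]/(P B) [in LHS](_ : B = \bigcup_j (B `&` W @^-1` [set j])).
    rewrite measure_fin_bigcup//; last first.
    - by move=> i j _ _ [x [[_ <-] [_ <-]]].
    - exact: finite_finset.
    - have -> : [set: J] = [set` index_enum J].
        by apply/seteqP; split => // j _; rewrite /= mem_index_enum.
      by rewrite -fsbig_seq ?index_enum_uniq.
  apply/seteqP; split => [x Bx|x [j _ []]//].
  by exists (W x).
by rewrite PB sum_fine// => j _; exact: fin_num_measure.
Qed.

Lemma mutual_info_fin_le {disp} {Om : measurableType disp} {R : realType}
    (P : probability Om R) (I J : finType) (Z : Om -> I) (W : Om -> J)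
    (A : {set J}) (n : nat) :
  (forall i, measurable (Z @^-1` [set i])) ->
  (forall j, measurable (W @^-1` [set j])) ->
  (forall w, W w \in A) -> (0 < n)%N -> (#|A| <= n)%N ->
  (mutual_info_fin P Z W <= log2 n%:R)%R.
Proof.
move=> mZ mW WA n0 An.
pose p i j := fine (P (Z @^-1` [set i] `&` W @^-1` [set j])).
have pZ i : fine (P (Z @^-1` [set i])) = (\sum_j p i j)%R.
  exact: prob_sum_cells.
have pW j : fine (P (W @^-1` [set j])) = (\sum_i p i j)%R.
  by rewrite (prob_sum_cells P (mW j) mZ); apply: eq_bigr => i _; rewrite setIC.
have p0 i j : (0 <= p i j)%R by rewrite fine_ge0.
have p1 : (\sum_i \sum_j p i j = 1)%R.
  under eq_bigr do rewrite -pZ.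
  have := prob_sum_cells P measurableT mZ; rewrite probability_setT /= => ->.
  by apply: eq_bigr => i _; rewrite setTI.
have pA i j : j \notin A -> p i j = 0%R.
  move=> jA; rewrite /p (_ : _ `&` _ = set0) ?measure0//.
  by rewrite -subset0 => w [_ Wj]; move: jA; rewrite -Wj WA.
have H := joint_entropy_bound n0 An p0 p1 pZ pW pA.
have l2 : (0 < ln 2 :> R)%R by rewrite ln_gt0// ltr1n.
have shE (K : finType) (q : K -> R) :
    (- \sum_k q k * log2 (q k) = - (\sum_k q k * ln (q k)) / ln 2)%R.
  by rewrite mulNr mulr_suml; congr (- _)%R; apply: eq_bigr => k _; rewrite mulrA.
rewrite /mutual_info_fin /shannon !shE -!mulrDl -mulNr -mulrDl.
rewrite ler_wpM2r// ?invr_ge0 ?(ltW l2)//.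
have -> : (\sum_k fine (P ((fun w => (Z w, W w)) @^-1` [set k])) *
    ln (fine (P ((fun w => (Z w, W w)) @^-1` [set k]))) =
    \sum_i \sum_j p i j * ln (p i j))%R.
  rewrite pair_bigA/=; apply: eq_bigr => -[i j] _ /=.
  suff -> : (fun w => (Z w, W w)) @^-1` [set (i, j)] =
    Z @^-1` [set i] `&` W @^-1` [set j] by [].
  by apply/seteqP; split => w /= [-> ->].
move: H; lra.
Qed.

(** * Rate distortion and metric mean dimension *)

(** The integral of a nonnegative function is the supremum of the integrals of
    its simple minorants, hence monotone on all nonnegative functions. *)
Lemma expectation_le_bound {disp} {Om : measurableType disp} {R : realType}
    (P : probability Om R) (f : Om -> R) (c : R) :
  (forall w, 0 <= f w)%R -> (forall w, f w <= c)%R -> 'E_P[f] <= c%:E.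
Proof.
move=> f0 fc; rewrite unlock.
have c0 : (0 <= c)%R by exact: le_trans (f0 point) (fc point).
have cE : \int[P]_w (cst c%:E) w = c%:E.
  by rewrite integral_cst// [X in _ * X]probability_setT mule1.
rewrite -[leRHS]cE !ge0_integralTE//.
apply: ereal_sup_le => _ [h hf <-]; exists h => // w.
by apply: le_trans (hf w) _; rewrite lee_fin.
Qed.

(** Choosing the first cell that contains a given point turns a finite
    measurable cover into a finite measurable partition subordinate to it. *)
Lemma measurable_selector {disp} {Om : measurableType disp} (n : nat)
    (U : 'I_n -> set Om) : (forall i, measurable (U i)) ->
  \bigcup_i U i = [set: Om] ->
  exists j : Om -> 'I_n, (forall x, U (j x) x) /\
    forall i, measurable (j @^-1` [set i]).
Proof.
move=> mU cU.
have ex x : exists i, U i x /\ forall k : 'I_n, (k < i)%N -> ~ U k x.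
  have [i0 _ Ui0] : (\bigcup_i U i) x by rewrite cU.
  have i0P : `[< U i0 x >] by apply/asboolP.
  case: (@arg_minnP _ i0 (fun i => `[< U i x >]) val i0P) => i /asboolP Ui mini.
  exists i; split => // k ki Uk; have /mini : `[< U k x >] by apply/asboolP.
  by rewrite leqNgt ki.
have [j jP] := choice ex; exists j; split; first by move=> x; have [] := jP x.
move=> i; rewrite (_ : j @^-1` [set i] =
  U i `\` \bigcup_(k in [set k : 'I_n | (k < i)%N]) U k).
  by apply: measurableD => //; apply: fin_bigcup_measurable.
apply/seteqP; split=> x /=.
  move=> <-; have [Ux min] := jP x; split=> // -[k /= kj]; exact: min.
move=> [Ui ni]; have [Uj minj] := jP x.
have [ij|ji|/val_inj//] := ltngtP (val i) (val (j x)).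
  by case: (minj _ ij Ui).
by case: ni; exists (j x).
Qed.

Lemma measurable_preimage_cells {disp} {Om : measurableType disp} (I : finType)
    (j : Om -> I) (B : set I) :
  (forall i, measurable (j @^-1` [set i])) -> measurable (j @^-1` B).
Proof.
move=> mj; rewrite (_ : j @^-1` B = \bigcup_(i in B) (j @^-1` [set i])).
  exact: fin_bigcup_measurable.
by apply/seteqP; split => x /= => [Bx|[i Bi ->]//]; exists (j x).
Qed.

Lemma mfun_of_measurable {d1 d2} {A : measurableType d1} {B : measurableType d2}
    (f : A -> B) : measurable_fun setT f ->
  exists g : {mfun A >-> B}, g = f :> (A -> B).
Proof. by move=> mf; exists (mfun_Sub (mem_set mf)). Qed.

(** Quantizing a point to the orbit of a representative of its cell, in a cover
    by cells of small [dyn_metric T d N]-diameter, costs at most the logarithm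
    of the number of cells. *)
Lemma rate_distortion_le {R : realType} {X : ptopologicalType} (T : X -> X)
    (d : X -> X -> R) (mu : probability (borel X) R) (e : R) (N n : nat)
    (U : 'I_n -> set X) : continuous_pseudometric d -> (0 < N)%N ->
  (forall i, open (U i)) -> \bigcup_i U i = [set: X] ->
  (forall i, diam (dyn_metric T d N) (U i) < e%:E) ->
  rate_distortion T d mu e <= (N%:R^-1 * log2 n%:R)%:E.
Proof.
move=> hd N0 oU cU dU.
have mU i : measurable (U i : set (borel X)) by exact: sub_sigma_algebra.
have [j [Uj mj]] := @measurable_selector _ (borel X) n U mU cU.
(* The default value concerns empty cells, which are never selected. *)
pose q i : X :=
  if pselect (exists x, U i x) is left h then projT1 (cid h) else point.
have Uq x : U (j x) (q (j x)).
  rewrite /q; case: pselect => [h|[]]; first exact: (projT2 (cid h)).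
  by exists x; exact: Uj.
have n0 : (0 < n)%N by case: (n) (j point) => // -[].
pose y (x : borel X) : N.-tuple (borel X) := [tuple iter k T (q (j x)) | k < N].
have my : measurable_fun setT y.
  move=> _ B mB; rewrite setTI.
  rewrite (_ : y @^-1` B = j @^-1` [set i | B [tuple iter k T (q i) | k < N]])//.
  exact: measurable_preimage_cells.
have [Z ZE] := mfun_of_measurable (@measurable_id _ (borel X) setT).
have [Y YE] := mfun_of_measurable my.
pose c := \big[Num.max/0%R]_i fine (diam (dyn_metric T d N) (U i)).
have ce : c%:E < e%:E.
  rewrite lte_fin; apply/bigmax_ltP; split.
    rewrite -lte_fin; apply: le_lt_trans (dU (j point)); exact: diam_ge0.
  by move=> i _; rewrite -lte_fin (fineK (diam_fin_num (dU i))).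
apply: ge_ereal_inf; exists (mutual_info mu Z Y * (N%:R^-1)%:E).
  exists N, _, (borel X), mu, Z, Y; split => //.
    by move=> A mA; rewrite /distribution/= /pushforward ZE.
  apply: le_lt_trans ce; rewrite ZE YE.
  have dc x k : (k < N)%N -> (d (iter k T x) (iter k T (q (j x))) <= c)%R.
    move=> kN; apply: (le_trans (dist_le_dyn_metric T d _ _ kN)).
    rewrite /c (bigD1 (j x))//= le_max -lee_fin (fineK (diam_fin_num (dU _))).
    by rewrite le_diam.
  apply: expectation_le_bound => x.
    by rewrite mulr_ge0 ?invr_ge0// sumr_ge0// => k _; exact: (cpm_ge0 hd).
  rewrite mulrC ler_pdivrMr ?ltr0n//.
  apply: (@le_trans _ _ (\sum_(k < N) c)%R); last first.
    by rewrite sumr_const card_ord mulr_natr.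
  by apply: ler_sum => k _; rewrite tnth_mktuple; exact: dc.
rewrite EFinM muleC; apply: lee_wpmul2l; first by rewrite lee_fin invr_ge0.
apply: ge_ereal_sup => _ [m [k [f [g [mf mg ->]]]]]; rewrite lee_fin ZE YE.
pose A := [set g [tuple iter l T (q i) | l < N] | i in 'I_n]%SET.
apply: (@mutual_info_fin_le _ (borel X) R mu _ _ (f \o id) (g \o y) A n) => //.
- by move=> i; have := my measurableT _ (mg i); rewrite setTI.
- by move=> x; apply/imsetP; exists (j x).
- by rewrite (leq_trans (leq_imset_card _ _))// card_ord.
Qed.

Lemma rate_distortion_le_S_entropy {R : realType} {X : ptopologicalType}
    (T : X -> X) (d : X -> X -> R) (mu : probability (borel X) R) (e : R) :
  compact [set: X] -> continuous T -> continuous_pseudometric d -> (0 < e)%R ->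
  rate_distortion T d mu e <= S_entropy T d e.
Proof.
move=> cX cT hd e0; have uS := S_entropy_cvg cX cT hd e0.
rewrite -(cvg_lim _ uS)//; apply: lime_ge; first by apply/cvg_ex; eexists; exact: uS.
near=> N; have [n [U [n1 cn oU cU dU]]] :=
  cov_number_attained cX (dyn_metric_continuous N cT hd) e0.
rewrite cn log2e_nat// -EFinM; apply: rate_distortion_le oU cU dU => //.
by near: N; exact: nbhs_infty_gt.
Unshelve. all: by end_near. Qed.

Lemma near_ratio_le {R : realType} (f g : R -> \bar R) :
  (forall e, (0 < e)%R -> f e <= g e) ->
  \forall e \near 0^'+,
    f e * ((log2 e^-1)^-1)%:E <= g e * ((log2 e^-1)^-1)%:E.
Proof.
move=> fg; apply: (@near_right0 _ 1) => // e e0 e1.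
apply: lee_wpmul2r; last exact: fg.
by rewrite lee_fin invr_ge0 log2_ge0// ltW// invf_gt1.
Qed.

(** * Generic grid cells avoid small sets *)

(** A Chernoff bound over the finite probability space of all choices of one
    grid cell per coordinate: the weight [rho^-1] to the number of hits has
    average at most [2 ^ #|I|], so more than [k] hits have probability at most
    [2 ^ #|I| * rho ^ k.+1]. *)
Lemma exists_sparse_choice {R : realType} (I : finType) (m p k : nat)
    (C : 'I_p -> I -> {set 'I_m}) (rho : 'I_p -> R) : (0 < m)%N ->
  (forall j, 0 < rho j)%R -> (forall j, rho j <= 1)%R ->
  (forall j i, #|C j i|%:R <= rho j * m%:R)%R ->
  (\sum_j 2 ^+ #|I| * rho j ^+ k.+1 < 1)%R ->
  exists c : {ffun I -> 'I_m},
    forall j, (#|[set i | c i \in C j i]%SET| <= k)%N.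
Proof.
move=> m0 r0 r1 Cr small; apply: contrapT => bad.
pose F j i (q : 'I_m) : R := if q \in C j i then (rho j)^-1%R else 1%R.
pose w j (c : {ffun I -> 'I_m}) := (rho j ^+ k.+1 * \prod_i F j i (c i))%R.
have F0 j i q : (0 < F j i q)%R by rewrite /F; case: ifP; rewrite ?invr_gt0.
have w0 j c : (0 <= w j c)%R.
  by rewrite mulr_ge0 ?exprn_ge0 ?(ltW (r0 j))// prodr_ge0// => i _; exact: ltW.
have w1 c : (1 <= \sum_j w j c)%R.
  have [j kj] : exists j, (k < #|[set i | c i \in C j i]%SET|)%N.
    apply: contrapT => nj; apply: bad; exists c => j; rewrite leqNgt.
    by apply/negP => kj; apply: nj; exists j.
  rewrite (bigD1 j)//= -[leLHS]addr0 lerD ?sumr_ge0// /w.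
  have -> : (\prod_i F j i (c i) = (rho j)^-1 ^+ #|[set i | c i \in C j i]%SET|)%R.
    rewrite -prodr_const [RHS]big_mkcond/=; apply: eq_bigr => i _.
    by rewrite /F inE.
  apply: (@le_trans _ _ (rho j ^+ k.+1 * (rho j)^-1 ^+ k.+1)%R).
    by rewrite -exprMn divff ?gt_eqF// expr1n.
  by rewrite ler_pM2l ?exprn_gt0// ler_weXn2l// invf_ge1.
have tot : (\sum_(c : {ffun I -> 'I_m}) \sum_j w j c < m%:R ^+ #|I|)%R.
  rewrite exchange_big/=.
  apply: (@le_lt_trans _ _ (\sum_j (2 ^+ #|I| * rho j ^+ k.+1) * m%:R ^+ #|I|)%R).
    apply: ler_sum => j _; rewrite -mulr_sumr -(bigA_distr_bigA (F j))/=.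
    rewrite mulrAC [leRHS]mulrC ler_wpM2l ?exprn_ge0 ?(ltW (r0 j))//.
    rewrite -exprMn -prodr_const; apply: ler_prod => i _.
    rewrite sumr_ge0 => [|q _]; last exact: ltW.
    rewrite (bigID (mem (C j i)))/=.
    rewrite mulr_natl mulr2n; apply: lerD.
      rewrite (eq_bigr (fun=> (rho j)^-1%R)) => [|q qC]; last by rewrite /F qC.
      by rewrite sumr_const -[leLHS]mulr_natl ler_pdivrMr// mulrC.
    rewrite (eq_bigr (fun=> 1%R)) => [|q qC]; last by rewrite /F (negbTE qC).
    by rewrite sumr_const ler_nat (leq_trans (max_card _))// card_ord.
  by rewrite -mulr_suml gtr_pMl// exprn_gt0 ?ltr0n.
move: tot; rewrite ltNge => /negP; apply.
have -> : (m%:R ^+ #|I| = \sum_(c : {ffun I -> 'I_m}) 1 :> R)%R.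
  by rewrite sumr_const card_ffun card_ord natrX.
by apply: ler_sum => c _.
Qed.

Lemma card_le_spread {R : realType} (m : nat) (S : {set 'I_m}) (B : R) :
  (0 <= B)%R -> (forall c c', c \in S -> c' \in S -> c'%:R <= c%:R + B)%R ->
  (#|S|%:R <= B + 1)%R.
Proof.
move=> B0 SB; have [->|[c0 c0S]] := set_0Vmem S.
  by rewrite cards0 addr_ge0.
case: (@arg_minnP _ c0 (mem S) val c0S) => c cS cmin.
pose t := Num.truncn B.
have h c' : c' \in S -> (c' - c <= t)%N.
  move=> c'S; rewrite /t truncn_ge_nat// natrB; last exact: cmin.
  by have := SB _ _ cS c'S; lra.
have inj : {in S &, injective (fun c' : 'I_m => inord (c' - c) : 'I_t.+1)}.
  move=> x y xS yS /= /(congr1 val)/=; rewrite !inordK ?ltnS ?h// => exy.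
  apply: val_inj; rewrite /= -(subnK (cmin x xS)) -(subnK (cmin y yS)).
  by rewrite [X in (X + _)%N]exy.
apply: (@le_trans _ _ t.+1%:R).
  rewrite ler_nat -(card_in_imset inj) (leq_trans (max_card _))// card_ord//.
by rewrite -natr1 lerD2r truncn_le.
Qed.

(** * Mapping a space to a simplicial complex of small dimension *)

Lemma continuous_row {R : realType} {X : topologicalType} (k : nat)
    (F : 'I_k -> X -> R) : (forall j, continuous (F j : X -> R^o)) ->
  continuous (fun x => \row_j F j x : 'rV[R]_k).
Proof.
move=> cF x A [P /= nP PA].
have : \forall y \near x, forall ij : 'I_1 * 'I_k, P ij.1 ij.2 (F ij.2 y).
  apply: filter_forall => -[i j] /=; apply: (cF j).
  by have := nP i j; rewrite mxE.
by apply: filterS => y h; apply: PA => i j; rewrite mxE; exact: (h (i, j)).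
Qed.

Lemma lipschitz_continuous {R : realType} {X : topologicalType}
    (d : X -> X -> R) (L : R) (f : X -> R) : continuous_pseudometric d ->
  (0 < L)%R -> (forall x y, `|f x - f y| <= L * d x y)%R ->
  continuous (f : X -> R^o).
Proof.
move=> hd L0 fL x; apply/cvgrPdist_lt => /= e e0.
apply: filterS (cpm_nbhs hd x (divr_gt0 e0 L0)) => y /= dxy.
by apply: le_lt_trans (fL x y) _; rewrite mulrC -ltr_pdivlMr.
Qed.

(** The vertices of the triangulated cube [0, 1]^I are the subsets [S] of [I].
    The weight of [S] at a point [g] of the cube is positive exactly when
    [S] is a strict superlevel set: every coordinate in [S] is positive and
    larger than every coordinate outside [S], which are less than 1. *)
Definition superlevel_weight {R : realType} (I : finType) (g : I -> R)
    (S : {set I}) : R :=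
  (\prod_(ij : I * I | (ij.1 \in S) && (ij.2 \notin S))
      Num.max 0 (g ij.1 - g ij.2) *
   (\prod_(i in S) g i * \prod_(i | i \notin S) (1 - g i)))%R.

Lemma superlevel_weight_ge0 {R : realType} (I : finType) (g : I -> R)
    (S : {set I}) : (forall i, 0 <= g i <= 1)%R ->
  (0 <= superlevel_weight g S)%R.
Proof.
move=> g01; rewrite /superlevel_weight !mulr_ge0 ?prodr_ge0// => i _.
- by rewrite le_max lexx.
- by have /andP[] := g01 i.
- by have /andP[_] := g01 i; rewrite subr_ge0.
Qed.

Lemma superlevel_weight_neq0 {R : realType} (I : finType) (g : I -> R)
    (S : {set I}) : (forall i, 0 <= g i <= 1)%R ->
  (superlevel_weight g S != 0)%R ->
  [/\ forall i j, i \in S -> j \notin S -> (g j < g i)%R,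
      forall i, i \in S -> (0 < g i)%R &
      forall i, i \notin S -> (g i < 1)%R].
Proof.
move=> g01; rewrite /superlevel_weight !mulf_eq0 !negb_or => /andP[h1 /andP[h2 h3]].
split=> [i j iS jS|i iS|i iS].
- move/prodf_neq0 : h1 => /(_ (i, j)); rewrite /= iS jS => /(_ isT).
  by apply: contra_neqT; rewrite -leNgt => h; apply/max_idPl; rewrite subr_le0.
- have /andP[gi0 _] := g01 i.
  by rewrite lt_neqAle eq_sym gi0 andbT; move/prodf_neq0 : h2; apply.
- have /andP[_ gi1] := g01 i.
  rewrite lt_neqAle gi1 andbT eq_sym -subr_eq0.
  by move/prodf_neq0 : h3; apply.
Qed.

Lemma superlevel_weight_gt0 {R : realType} (I : finType) (g : I -> R) :
  (0 < superlevel_weight g [set i | (2^-1 <= g i)%R]%SET)%R.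
Proof.
rewrite /superlevel_weight !mulr_gt0 ?prodr_gt0// => [[i j]|i|i] /=.
- rewrite !inE -ltNge => /andP[hi hj].
  by rewrite lt_max; apply/orP; right; lra.
- by rewrite !inE => hi; lra.
- by rewrite !inE -ltNge => hi; lra.
Qed.

(** The superlevel sets of a point form a chain between the set of coordinates
    equal to 1 and the set of positive coordinates. *)
Lemma card_superlevel {R : realType} (I : finType) (g : I -> R) (k : nat) :
  (forall i, 0 <= g i <= 1)%R ->
  (#|[set i | (0 < g i < 1)%R]%SET| <= k)%N ->
  (#|[set S : {set I} | superlevel_weight g S != 0%R]%SET| <= k.+1)%N.
Proof.
move=> g01 fk; set W := [set S | _]%SET.
pose A := [set i | g i == 1%R]%SET.
have WS S : S \in W -> [/\ forall i j, i \in S -> j \notin S -> (g j < g i)%R,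
    forall i, i \in S -> (0 < g i)%R & forall i, i \notin S -> (g i < 1)%R].
  by rewrite inE; exact: superlevel_weight_neq0.
have AS S : S \in W -> A \subset S.
  move=> /WS[_ _ S1]; apply/fintype.subsetP => i; rewrite inE => /eqP gi.
  by apply: contraT => /S1; rewrite gi ltxx.
have Sk S : S \in W -> (#|S| - #|A| <= k)%N.
  move=> SW; rewrite -(cardsDS (AS S SW)).
  apply: leq_trans fk; apply: subset_leq_card; apply/fintype.subsetP => i.
  rewrite !inE => /andP[gi iS]; have [_ Spos _] := WS S SW.
  by rewrite Spos// lt_neqAle gi/=; have /andP[] := g01 i.
have chain S S' : S \in W -> S' \in W -> #|S| = #|S'| -> S = S'.
  move=> SW S'W ee; have [hS _ _] := WS S SW; have [hS' _ _] := WS S' S'W.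
  apply/eqP; rewrite eqEcard ee leqnn andbT; apply/fintype.subsetP => i iS.
  apply: contraT => iS'.
  have : ~~ (S' \subset S).
    apply/negP => S'S; have : S' == S by rewrite eqEcard S'S ee leqnn.
    by move=> /eqP SS; move: iS'; rewrite SS iS.
  case/fintype.subsetPn => j jS' jS.
  by have := lt_trans (hS _ _ iS jS) (hS' _ _ jS' iS'); rewrite ltxx.
have inj : {in W &, injective (fun S : {set I} => inord (#|S| - #|A|) : 'I_k.+1)}.
  move=> S S' SW S'W /= /(congr1 val)/=; rewrite !inordK ?ltnS ?Sk// => ee.
  apply: chain => //.
  rewrite -(subnK (subset_leq_card (AS S SW))) ee subnK//.
  exact: subset_leq_card (AS S' S'W).
by rewrite -(card_in_imset inj) (leq_trans (max_card _))// card_ord.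
Qed.

Lemma superlevel_weight_continuous {R : realType} {X : topologicalType}
    (I : finType) (g : I -> X -> R) (S : {set I}) :
  (forall i, continuous (g i : X -> R^o)) ->
  continuous (fun x => superlevel_weight (g^~ x) S : R^o).
Proof.
move=> cg x; rewrite /superlevel_weight.
have cprod (J : finType) (P : pred J) (f : J -> X -> R^o) :
    (forall j, continuous (f j)) -> {for x, continuous
      (fun y => \prod_(j | P j) f j y : R^o)%R}.
  by move=> cf; apply: (continuous_big mul_continuous) => j _; exact: cf.
apply: (@continuousM R X); last apply: (@continuousM R X); apply: cprod => j y.
- apply: (@continuous_max R X (cst 0%R)); first exact: cst_continuous.
  by apply: continuousB; exact: cg.
- exact: cg.
- by apply: continuousB; [exact: cst_continuous|exact: cg].
Qed.

(** If at every point at most [k] of the coordinates [g i] lie strictly between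
    0 and 1, the normalized superlevel weights map [X] to a [k]-dimensional
    complex. Two points in the same fiber share a superlevel set, which rules
    out that some coordinate is 1 at the first point and 0 at the second. *)
Lemma widim_le {R : realType} {X : ptopologicalType} (d : X -> X -> R)
    (I : finType) (g : I -> X -> R) (k : nat) (e' e : R) :
  (forall i, continuous (g i : X -> R^o)) ->
  (forall i x, 0 <= g i x <= 1)%R ->
  (forall x, (#|[set i | (0 < g i x < 1)%R]%SET| <= k)%N) ->
  (0 <= e')%R -> (e' < e)%R ->
  (forall x y, (forall i, g i x = 1%R -> g i y <> 0%R) -> (d x y <= e')%R) ->
  widim d e <= k%:R%:E.
Proof.
move=> cg g01 gk e'0 e'e sep.
pose V := #|{set I}|.
have V0 : (0 < V)%N by apply/card_gt0P; exists finset.set0.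
pose K : {set {set 'I_V}} :=
  [set s : {set 'I_V} | (s != finset.set0) && (#|s| <= k.+1)%N]%SET.
pose phi (v : 'I_V) x : R := superlevel_weight (g^~ x) (enum_val v).
pose tot x : R := (\sum_v phi v x)%R.
have phi0 v x : (0 <= phi v x)%R by apply: superlevel_weight_ge0 => i; exact: g01.
have tot0 x : (0 < tot x)%R.
  pose S := [set i | (2^-1 <= g i x)%R]%SET.
  apply: (@lt_le_trans _ _ (phi (enum_rank S) x)).
    by rewrite /phi enum_rankK; exact: superlevel_weight_gt0.
  by rewrite /tot (bigD1 (enum_rank S))//= lerDl sumr_ge0.
pose f x : 'rV[R]_V := \row_v (phi v x / tot x)%R.
have f0 v x : (f x ord0 v != 0%R) = (phi v x != 0%R).
  by rewrite mxE mulf_eq0 invr_eq0 (gt_eqF (tot0 x)) orbF.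
have fK x : [set v | f x ord0 v != 0%R]%SET \in K.
  rewrite inE; apply/andP; split.
    apply/finset.set0Pn; apply: contrapT => no.
    have : tot x = 0%R.
      rewrite /tot big1// => v _; apply/eqP; apply: contrapT => /negP nz.
      by apply: no; exists v; rewrite inE f0.
    by apply/eqP; rewrite gt_eqF.
  have := @card_superlevel R I (g^~ x) k (fun i => g01 i x) (gk x).
  apply: leq_trans; rewrite -(card_imset _ (@enum_val_inj _ _)).
  apply: subset_leq_card; apply/fintype.subsetP => _ /imsetP[v + ->].
  by rewrite !inE f0.
pose n := (\max_(s in K) #|s|)%N.
have n0 : (0 < n)%N.
  apply: leq_trans (leq_bigmax_cond _ (fK point)); rewrite card_gt0.
  by have := fK point; rewrite inE => /andP[].
have nk : (n <= k.+1)%N by apply/bigmax_leqP => s; rewrite inE => /andP[].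
apply: (@le_trans _ _ n.-1%:R%:E); last by rewrite lee_fin ler_nat -ltnS prednK.
apply: min_nat_le; exists V, K, f; split.
- move=> s; rewrite inE => /andP[s0 sk]; split=> // t ts t0.
  by rewrite inE t0 (leq_trans (subset_leq_card ts)).
- by rewrite /complex_dim prednK.
- move=> _ [x _ <-]; split=> //.
    by move=> v; rewrite mxE divr_ge0// ltW.
  under eq_bigr do rewrite mxE.
  by rewrite -mulr_suml -/(tot x) divff// gt_eqF.
split.
  apply: continuous_row => v x.
  apply: continuousM.
    exact: superlevel_weight_continuous.
  apply: continuousV; first by rewrite gt_eqF.
  apply: (continuous_big add_continuous) => w _.
  exact: superlevel_weight_continuous.
move=> y; apply: (@le_lt_trans _ _ e'%:E); last by rewrite lte_fin.
apply: diam_le => // a b /= fa fb; apply: sep => i gia gib.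
have [v] : exists v, v \in [set v | f a ord0 v != 0%R]%SET.
  by apply/finset.set0Pn; have := fK a; rewrite inE => /andP[].
rewrite inE => /[dup]; rewrite {2}fa -fb !f0 => va vb.
have [_ _ a1] := superlevel_weight_neq0 (fun i => g01 i a) va.
have [_ b1 _] := superlevel_weight_neq0 (fun i => g01 i b) vb.
have [iv|iv] := boolP (i \in enum_val v).
  by have := b1 _ iv; rewrite gib ltxx.
by have := a1 _ iv; rewrite gia ltxx.
Qed.

(** * From Hausdorff content to width dimension *)

Definition clamp {R : realType} (t : R) : R := (Num.max 0 (Num.min t 1))%R.

Lemma clamp_itv {R : realType} (t : R) : (0 <= clamp t <= 1)%R.
Proof. by rewrite /clamp le_max lexx ge_max ler01 ge_min lexx orbT. Qed.

Lemma clamp_ge1 {R : realType} (t : R) : (1 <= t)%R -> clamp t = 1%R.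
Proof. by move=> t1; rewrite /clamp (min_idPr t1); apply/max_idPr. Qed.

Lemma clamp_le0 {R : realType} (t : R) : (t <= 0)%R -> clamp t = 0%R.
Proof. by move=> t0; apply/max_idPl; rewrite ge_min t0. Qed.

Lemma clamp_interior {R : realType} (t : R) :
  (0 < clamp t < 1)%R -> (0 < t < 1)%R.
Proof.
case: (leP t 0%R) => t0; first by rewrite clamp_le0// ltxx.
by case: (ltP t 1%R) => t1//; rewrite clamp_ge1// ltxx andbF.
Qed.

Lemma clamp_lipschitz {R : realType} (s t : R) :
  (`|clamp s - clamp t| <= `|s - t|)%R.
Proof.
have h (a b : R) : (a <= b -> clamp b - clamp a <= b - a)%R.
  by rewrite /clamp /Num.max /Num.min; do 4 case: ifPn; rewrite -?leNgt; lra.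
have m (a b : R) : (a <= b -> clamp a <= clamp b)%R.
  by rewrite /clamp /Num.max /Num.min; do 4 case: ifPn; rewrite -?leNgt; lra.
wlog st : s t / (s <= t)%R.
  move=> W; have [/W//|ts] := leP s t.
  by rewrite distrC [leRHS]distrC; apply: W; exact: ltW.
rewrite distrC [leRHS]distrC !ger0_norm ?subr_ge0 ?m//; exact: h.
Qed.

(** Each diameter may be enlarged strictly, at any prescribed cost in [r ^ s],
    because [r |-> r ^ s] is continuous and increasing for positive [s]. *)
Lemma enlarge_radius {R : realType} (t s delta eta : R) :
  (0 <= t)%R -> (t < delta)%R -> (0 < s)%R -> (0 < eta)%R ->
  exists r, [/\ (t < r)%R, (r < delta)%R & (r `^ s <= t `^ s + eta)%R].
Proof.
move=> t0 td s0 eta0.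
pose r1 := ((t `^ s + eta) `^ s^-1)%R.
have ts0 : (0 <= t `^ s + eta)%R by rewrite addr_ge0 ?powR_ge0// ltW.
have r1s : (r1 `^ s = t `^ s + eta)%R.
  by rewrite /r1 -powRrM mulVf ?gt_eqF// powRr1.
have tr1 : (t < r1)%R.
  rewrite ltNge; apply/negP => r1t.
  have : (r1 `^ s <= t `^ s)%R.
    by rewrite ge0_ler_powR ?nnegrE ?powR_ge0// ltW.
  by rewrite r1s; lra.
exists (Num.min r1 ((t + delta) / 2))%R; split.
- by rewrite lt_min tr1/=; lra.
- by rewrite gt_min; apply/orP; right; lra.
- rewrite -r1s ge0_ler_powR ?nnegrE ?(ltW s0) ?powR_ge0 ?ge_min ?lexx//.
  by rewrite le_min powR_ge0/=; lra.
Qed.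

(** Thickening the [n]-th set of a countable cover at a cost of at most
    [2 ^- n.+1] makes it open, so compactness leaves finitely many sets. Their
    radii are now positive, as a comparison with a finite grid requires. *)
Lemma hausdorff_content_open_cover {R : realType} {X : ptopologicalType}
    (d : X -> X -> R) (s delta : R) : compact [set: X] ->
  continuous_pseudometric d -> (0 < s)%R -> hausdorff_content d s delta < 1 ->
  exists p (U : 'I_p -> set X) (r : 'I_p -> R),
    [/\ \bigcup_n U n = [set: X],
        forall n x y, U n x -> U n y -> (d x y <= r n)%R,
        forall n, (0 < r n)%R, forall n, (r n < delta)%R &
        (\sum_n r n `^ s < 2)%R].
Proof.
move=> cX hd s0 /ereal_inf_lt[_ [E [cE dE] <-] Elt].
pose t n : R := fine (diam d (E n)).
have tE n : (t n)%:E = diam d (E n) by rewrite /t (fineK (diam_fin_num (dE n))).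
have t0 n : (0 <= t n)%R by rewrite fine_ge0 ?diam_ge0.
have td n : (t n < delta)%R by rewrite -lte_fin tE.
have ps n : (t n `^ s)%:E <= diam_pow d s (E n).
  rewrite /diam_pow -poweR_EFin tE; case: eqP => [->|_]//.
  by rewrite diam_set0 poweR0r// gt_eqF.
have eta0 n : (0 < (2^-1 ^+ n.+1 : R))%R by rewrite exprn_gt0.
have [r rP] := choice (fun n => enlarge_radius (t0 n) (td n) s0 (eta0 n)).
pose U n := [set y | exists2 x, E n x & (d x y < (r n - t n) / 2)%R].
have Uopen n : open (U n).
  rewrite (_ : U n = \bigcup_(x in E n) [set y | (d x y < (r n - t n) / 2)%R]).
    by apply: bigcup_open => x _; exact: cpm_ball_open.
  by apply/seteqP; split => y [x Ex dx]; exists x.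
have UX : \bigcup_n U n = [set: X].
  apply/seteqP; split => // x _.
  have [n _ Ex] : (\bigcup_n E n) x by rewrite cE.
  exists n => //; exists x => //; rewrite (cpm_refl hd).
  by have [tr _ _] := rP n; lra.
have [k [f fU]] := compact_finite_cover cX Uopen UX.
pose p := (\max_i f i).+1.
exists p, (fun n => U n), (fun n => r n); split.
- apply/seteqP; split => // x _.
  have [i _ Ui] : (\bigcup_i U (f i)) x by rewrite fU.
  have fp : (f i < p)%N by rewrite ltnS; exact: leq_bigmax.
  by exists (Ordinal fp).
- move=> n x y [a Ea dax] [b Eb dby].
  have dab : (d a b <= t n)%R by rewrite -lee_fin tE; exact: le_diam.
  have := cpm_triangle hd x a y; have := cpm_triangle hd a b y.
  by rewrite (cpm_sym hd x a); lra.
- by move=> n; have [tr _ _] := rP n; exact: le_lt_trans (t0 n) tr.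
- by move=> n; have [_ rd _] := rP n.
have geo m : (\sum_(n < m) 2^-1 ^+ n.+1 = 1 - 2^-1 ^+ m :> R)%R.
  elim: m => [|m IH]; first by rewrite big_ord0 expr0 subrr.
  by rewrite big_ord_recr/= IH exprS; lra.
have st : (\sum_(n < p) t n `^ s < 1)%R.
  rewrite -lte_fin; apply: le_lt_trans Elt.
  rewrite -sumEFin; apply: (@le_trans _ _ (\sum_(0 <= n < p) diam_pow d s (E n))).
    by rewrite big_mkord; apply: lee_sum.
  apply: nneseries_lim_ge => n _ _; rewrite /diam_pow; case: ifPn => // _.
  exact: poweR_ge0.
apply: (@le_lt_trans _ _ (\sum_(n < p) (t n `^ s + 2^-1 ^+ n.+1))%R).
  by apply: ler_sum => n _; have [_ _] := rP n.
rewrite big_split/= geo; have : (0 < 2^-1 ^+ p :> R)%R by rewrite exprn_gt0.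
lra.
Qed.

(** The grid is so fine that a set of radius [r] meets, in each coordinate, a
    fraction at most [(L + 1) * r] of the cells. Choosing one cell per
    coordinate by [exists_sparse_choice] and stretching it to [0, 1] leaves at
    most [k] coordinates of any point strictly between 0 and 1. *)
Lemma widim_le_of_content {R : realType} {X : ptopologicalType}
    (d : X -> X -> R) (I : finType) (h : I -> X -> R) (L s delta e' e : R)
    (k : nat) : compact [set: X] -> continuous_pseudometric d ->
  (0 < L)%R -> (0 < s)%R -> (s <= k.+1%:R)%R -> (0 <= e')%R -> (e' < e)%R ->
  (forall i x y, `|h i x - h i y| <= L * d x y)%R ->
  (forall i x, 0 <= h i x <= 1)%R ->
  (forall x y, (forall i, h i x = 1%R -> h i y <> 0%R) -> (d x y <= e')%R) ->
  ((L + 1) * delta <= 1)%R ->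
  (2 * (2 ^+ #|I| * (L + 1) ^+ k.+1 * delta `^ (k.+1%:R - s)) <= 1)%R ->
  hausdorff_content d s delta < 1 -> widim d e <= k%:R%:E.
Proof.
move=> cX hd L0 s0 sk e'0 e'e hL h01 sep Ld small Hlt.
have [p [U [r [cU dU r0 rd rs]]]] := hausdorff_content_open_cover cX hd s0 Hlt.
(* With [2 <= m * r n], the incompletely covered cells at both ends of an
   interval of length [L * r n] only change [L] to [L + 1]. *)
pose m := (Num.truncn (\sum_n 2 / r n)%R).+1.
have mr n : (2 <= m%:R * r n)%R.
  have : (2 / r n <= m%:R)%R.
    apply: (@le_trans _ _ (\sum_n 2 / r n)%R).
      by rewrite (bigD1 n)//= lerDl sumr_ge0// => j _; rewrite divr_ge0// ltW.
    by apply: ltW; rewrite real_truncnS_gt// num_real.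
  by rewrite ler_pdivrMr.
pose C n i := [set c : 'I_m |
  `[< exists2 x, U n x & (0 < m%:R * h i x - c%:R < 1)%R >]]%SET.
pose rho n : R := ((L + 1) * r n)%R.
have L10 : (0 < L + 1)%R by rewrite addr_gt0.
have [||||c cP] := @exists_sparse_choice R I m p k C rho isT.
- by move=> n; rewrite mulr_gt0.
- by move=> n; apply: le_trans Ld; rewrite ler_pM2l// ltW.
- move=> n i; apply: (@le_trans _ _ (m%:R * (L * r n) + 1 + 1)%R).
    apply: card_le_spread => [|a b].
      by rewrite addr_ge0// !mulr_ge0// ltW.
    rewrite !inE => /asboolP[x Ux /andP[_ xa]] /asboolP[y Uy /andP[by0 _]].
    have hxy : (h i y - h i x <= L * r n)%R.
      apply: le_trans (ler_norm _) _; apply: (le_trans (hL _ _ _)).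
      by rewrite ler_pM2l//; exact: (dU n).
    have : (m%:R * (h i y - h i x) <= m%:R * (L * r n))%R by rewrite ler_wpM2l.
    by rewrite mulrBr; lra.
  by rewrite /rho; have := mr n; lra.
- have term n : (rho n ^+ k.+1 <=
      (L + 1) ^+ k.+1 * delta `^ (k.+1%:R - s) * r n `^ s)%R.
    rewrite /rho exprMn -mulrA ler_pM2l ?exprn_gt0//.
    rewrite -[leLHS](powR_mulrn _ (ltW (r0 n))) -{1}(subrK s k.+1%:R)%R.
    rewrite powRD; last by rewrite (gt_eqF (r0 n)) implybT.
    rewrite ler_wpM2r ?powR_ge0// ge0_ler_powR ?subr_ge0// ?nnegrE ltW//.
    exact: lt_trans (rd n).
  apply: (@le_lt_trans _ _ (2 ^+ #|I| * (L + 1) ^+ k.+1 *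
      delta `^ (k.+1%:R - s) * \sum_n r n `^ s)%R).
    rewrite mulr_sumr; apply: ler_sum => n _.
    by rewrite -!mulrA ler_pM2l ?exprn_gt0// mulrA; exact: term.
  set A := (_ * _ * _)%R in small *.
  have [A0|A0] := leP A 0%R.
    apply: (@le_lt_trans _ _ 0%R) => //; rewrite mulr_le0_ge0// sumr_ge0// => n _.
    exact: powR_ge0.
  have : (A * (\sum_n r n `^ s) < A * 2)%R by rewrite ltr_pM2l.
  lra.
pose g i x := clamp (m%:R * h i x - (c i)%:R)%R.
apply: (@widim_le R X d I g k e' e) => //.
- move=> i; apply: (@lipschitz_continuous _ _ d (m%:R * L)%R) => //.
    by rewrite mulr_gt0// ltr0n.
  move=> x y; apply: (le_trans (clamp_lipschitz _ _)).
  rewrite (_ : _ - _ = m%:R * (h i x - h i y))%R; last by ring.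
  by rewrite normrM ger0_norm// -mulrA ler_wpM2l.
- by move=> i x; exact: clamp_itv.
- move=> x; have [n _ Ux] : (\bigcup_n U n) x by rewrite cU.
  apply: leq_trans (cP n); apply: subset_leq_card; apply/fintype.subsetP => i.
  rewrite !inE => /clamp_interior hx; apply/asboolP; by exists x.
- move=> x y gxy; apply: sep => i hx hy; apply: (gxy i).
    apply: clamp_ge1; rewrite hx mulr1 lerBrDr -natr1.
    by rewrite addrC lerD2r ler_nat -ltnS.
  by apply: clamp_le0; rewrite hy mulr0 sub0r oppr_le0.
Qed.

(** * Mean dimension and mean Hausdorff dimension *)

Lemma separating_cutoffs {R : realType} {X : ptopologicalType}
    (d : X -> X -> R) (r : R) : compact [set: X] ->
  continuous_pseudometric d -> (0 < r)%R ->
  exists M (h : 'I_M -> X -> R),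
    [/\ forall i x, (0 <= h i x <= 1)%R,
        forall i x y, (`|h i x - h i y| <= r^-1 * d x y)%R &
        forall x y, (forall i, h i x = 1%R -> h i y <> 0%R) ->
          (d x y <= 3 * r)%R].
Proof.
move=> cX hd r0.
have [||M [f fc]] := @compact_finite_cover X X
  (fun p => [set x | (d p x < r)%R]) cX.
- by move=> p; exact: cpm_ball_open.
- by apply/seteqP; split => // x _; exists x => //=; rewrite (cpm_refl hd).
exists M, (fun i x => clamp (2 - d (f i) x / r)%R); split => [i x|i x y|x y sep].
- exact: clamp_itv.
- apply: (le_trans (clamp_lipschitz _ _)).
  rewrite (_ : _ - _ = r^-1 * (d (f i) y - d (f i) x))%R; last by ring.
  rewrite normrM gtr0_norm ?invr_gt0// ler_pM2l ?invr_gt0//.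
  have h1 := cpm_triangle hd (f i) x y; have h2 := cpm_triangle hd (f i) y x.
  by rewrite (cpm_sym hd y x) in h2; rewrite ler_norml; lra.
- rewrite leNgt; apply/negP => dxy.
  have [i _ /= fx] : (\bigcup_i [set x | (d (f i) x < r)%R]) x by rewrite fc.
  apply: (sep i).
    apply: clamp_ge1; have : (d (f i) x / r <= 1)%R by rewrite ler_pdivrMr// mul1r ltW.
    lra.
  apply: clamp_le0; rewrite subr_le0 ler_pdivlMr//.
  by have := cpm_triangle hd x (f i) y; rewrite (cpm_sym hd x (f i)); lra.
Qed.

Lemma separating_cutoffs_dyn {R : realType} {X : Type} (T : X -> X)
    (d : X -> X -> R) (M N : nat) (h : 'I_M -> X -> R) (L e' : R) :
  (0 <= L)%R -> (0 <= e')%R ->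
  (forall i x y, `|h i x - h i y| <= L * d x y)%R ->
  (forall x y, (forall i, h i x = 1%R -> h i y <> 0%R) -> (d x y <= e')%R) ->
  let hN (ij : 'I_M * 'I_N) x := h ij.1 (iter ij.2 T x) in
  (forall ij x y, `|hN ij x - hN ij y| <= L * dyn_metric T d N x y)%R /\
  (forall x y, (forall ij, hN ij x = 1%R -> hN ij y <> 0%R) ->
    (dyn_metric T d N x y <= e')%R).
Proof.
move=> L0 e'0 hL sep hN; split=> [[i j] x y|x y hxy].
  apply: (le_trans (hL _ _ _)); rewrite ler_wpM2l//.
  exact: dist_le_dyn_metric.
apply/dyn_metric_le => // n nN; apply: sep => i.
exact: (hxy (i, Ordinal nN)).
Qed.

Lemma hausdorff_dim_le_mono {R : realType} {X : Type} (d : X -> X -> R)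
    (delta delta' : R) : (delta <= delta')%R ->
  hausdorff_dim d delta' <= hausdorff_dim d delta.
Proof.
move=> dd; apply: ereal_sup_le => _ [s [s0 Hs] <-]; exists s => //; split => //.
apply: le_trans Hs _; apply: ereal_inf_le_tmp => _ [E [cE dE] <-].
exists E => //; split => // n; apply: lt_le_trans (dE n) _.
by rewrite lee_fin.
Qed.

Lemma hausdorff_dim_ge0 {R : realType} {X : pointedType} (d : X -> X -> R)
    (delta : R) : 0 <= hausdorff_dim d delta.
Proof.
apply: ereal_sup_ubound; exists 0%R => //; split => //.
apply: le_ereal_inf_tmp => _ [E [cE dE] <-].
have [n _ En] : (\bigcup_n E n) point by rewrite cE.
have p0 k : 0 <= diam_pow d 0 (E k).
  by rewrite /diam_pow; case: ifP => // _; exact: poweR_ge0.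
have pn : diam_pow d 0 (E n) = 1.
  by rewrite /diam_pow ifF ?poweRe0//; apply/eqP => E0; rewrite E0 in En.
apply: (@le_trans _ _ (\sum_(0 <= k < n.+1) diam_pow d 0 (E k))).
  by rewrite big_nat_recr//= pn; apply: leeDr; exact: sume_ge0.
exact: nneseries_lim_ge.
Qed.

(** The content increases as [delta] decreases to 0, so the limit defining
    [mdimH] exists and is a supremum over all scales. *)
Lemma limsup_hausdorff_dim_le_mdimH {R : realType} {X : Type} (T : X -> X)
    (d : X -> X -> R) (delta : R) : (0 < delta)%R ->
  limn_esup (fun N : nat =>
    (N%:R^-1)%:E * hausdorff_dim (dyn_metric T d N) delta) <= mdimH T d.
Proof.
move=> delta0; pose H (e : R) := limn_esup (fun N : nat =>
  (N%:R^-1)%:E * hausdorff_dim (dyn_metric T d N) e).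
have Hmono : {in `]0%R, +oo[ &, nonincreasing_fun H}.
  move=> a b _ _ ab; apply: limf_esup_le_near; near=> N.
  apply: lee_wpmul2l; first by rewrite lee_fin invr_ge0.
  exact: hausdorff_dim_le_mono.
have cH := @nonincreasing_at_right_cvge R H 0%R (BInfty R false) isT Hmono.
rewrite /mdimH (cvg_lim _ cH)//; apply: ereal_sup_ubound.
by exists delta => //=; rewrite in_itv/= delta0.
Unshelve. all: by end_near. Qed.

Lemma mdimH_ge0 {R : realType} {X : pointedType} (T : X -> X)
    (d : X -> X -> R) : 0 <= mdimH T d.
Proof.
apply: le_trans (@limsup_hausdorff_dim_le_mdimH R X T d 1%R ltr01).
apply: limf_esup_ge0 => [|N]; first exact: (@filter_not_empty _ \oo).
by rewrite mule_ge0 ?hausdorff_dim_ge0// lee_fin invr_ge0.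
Qed.

(** With [mdimH < D' < D], the error factor of [widim_le_of_content] for
    [M * N] coordinates, content exponent [D' * N] and [k ~ D * N] is at most
    [2 * (2 ^ M * (L + 1) ^ (D + 1) * delta ^ (D - D')) ^ N]; the base is at
    most 1/2 once [delta] is small, uniformly in [N]. *)
Lemma widim_dyn_le {R : realType} {X : ptopologicalType} (T : X -> X)
    (d : X -> X -> R) (e D : R) : compact [set: X] -> continuous T ->
  continuous_pseudometric d -> (0 < e)%R -> mdimH T d < D%:E ->
  \forall N \near \oo, widim (dyn_metric T d N) e * (N%:R^-1)%:E <= D%:E.
Proof.
move=> cX cT hd e0 HD.
(* Cutoffs of radius [e / 6] separate points at distance more than [e / 2]. *)
have r0 : (0 < e / 6)%R by rewrite divr_gt0.
have [M [h [h01 hL sep]]] := separating_cutoffs cX hd r0.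
set L := (e / 6)^-1%R in hL.
have L0 : (0 < L)%R by rewrite invr_gt0.
have [D' [HD' D'D]] : exists D' : R, mdimH T d < D'%:E /\ (D' < D)%R.
  have := mdimH_ge0 T d; move: HD; case: (mdimH T d) => [x|//|//].
  rewrite lte_fin => xD _; exists ((x + D) / 2)%R; rewrite lte_fin; lra.
have D'0 : (0 < D')%R by rewrite -lte_fin; exact: le_lt_trans (mdimH_ge0 T d) HD'.
have D0 : (0 < D)%R by exact: lt_trans D'D.
have L10 : (0 < L + 1)%R by rewrite addr_gt0.
pose A := (2 ^+ M * (L + 1) `^ (D + 1))%R.
have A0 : (0 < A)%R by rewrite mulr_gt0 ?exprn_gt0 ?powR_gt0.
have DD' : (0 < D - D')%R by rewrite subr_gt0.
pose delta := Num.min ((2 * A)^-1 `^ (D - D')^-1)%R (L + 1)^-1%R.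
have delta0 : (0 < delta)%R.
  by rewrite lt_min invr_gt0 L10 andbT powR_gt0// invr_gt0 mulr_gt0.
have deltaL : ((L + 1) * delta <= 1)%R.
  by rewrite mulrC -ler_pdivlMr// mul1r ge_min lexx orbT.
have delta1 : (delta <= 1)%R.
  by rewrite ge_min; apply/orP; right; rewrite invf_le1//; lra.
have deltaA : (A * delta `^ (D - D') <= 2^-1)%R.
  have : (delta `^ (D - D') <= (2 * A)^-1)%R.
    have -> : ((2 * A)^-1 = ((2 * A)^-1 `^ (D - D')^-1) `^ (D - D'))%R.
      by rewrite -powRrM mulVf ?gt_eqF// powRr1// invr_ge0 mulr_ge0// ltW.
    rewrite ge0_ler_powR ?nnegrE ?powR_ge0 ?(ltW delta0) ?(ltW DD')//.
    by rewrite ge_min lexx.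
  by rewrite -(ler_pM2l A0) invfM mulrCA divff ?gt_eqF// mulr1.
have := le_lt_trans (@limsup_hausdorff_dim_le_mdimH R X T d delta delta0) HD'.
move=> /limf_esup_lt nearH; near=> N.
have N0 : (0 < N)%N by near: N; exact: nbhs_infty_gt.
have NR : (0 < N%:R :> R)%R by rewrite ltr0n.
have HN : (N%:R^-1)%:E * hausdorff_dim (dyn_metric T d N) delta < D'%:E.
  by near: N.
pose s := (D' * N%:R)%R; have s0 : (0 < s)%R by rewrite mulr_gt0.
have content : hausdorff_content (dyn_metric T d N) s delta < 1.
  rewrite ltNge; apply/negP => H1; move: HN; apply/negP; rewrite -leNgt.
  rewrite [leLHS](_ : _ = (N%:R^-1)%:E * s%:E); last first.
    by rewrite -EFinM /s mulrCA mulVf ?gt_eqF// mulr1.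
  apply: lee_wpmul2l; first by rewrite lee_fin invr_ge0.
  by apply: ereal_sup_ubound; exists s => //; split=> //; exact: ltW.
pose k := Num.truncn (D * N%:R)%R.
have DN0 : (0 <= D * N%:R)%R by rewrite mulr_ge0// ltW.
have kD : (k%:R <= D * N%:R)%R by rewrite truncn_le.
have Dk : (D * N%:R < k.+1%:R)%R by rewrite real_truncnS_gt// num_real.
have [hLN sepN] := @separating_cutoffs_dyn R X T d M N h L (3 * (e / 6))%R
  (ltW L0) (mulr_ge0 (ler0n R 3) (ltW r0)) hL sep.
suff wk : widim (dyn_metric T d N) e <= k%:R%:E.
  apply: (@le_trans _ _ (k%:R%:E * (N%:R^-1)%:E)).
    by apply: lee_wpmul2r => //; rewrite lee_fin invr_ge0.
  by rewrite -EFinM lee_fin ler_pdivrMr.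
apply: (widim_le_of_content cX (dyn_metric_continuous N cT hd) L0 s0 _ _ _
  hLN _ sepN deltaL _ content) => //.
- apply: ltW; apply: le_lt_trans Dk; rewrite /s ler_pM2r//; exact: ltW.
- by rewrite mulr_ge0// ltW.
- lra.
rewrite card_prod !card_ord exprM.
have Lk : ((L + 1) ^+ k.+1 <= ((L + 1) `^ (D + 1)) ^+ N)%R.
  rewrite -(powR_mulrn k.+1 (ltW L10)) -(powR_mulrn N (powR_ge0 _ _)) -powRrM.
  apply: ler_powR; first by lra.
  rewrite -natr1 mulrDl mul1r lerD// ler1n//.
have dk : (delta `^ (k.+1%:R - s) <= (delta `^ (D - D')) ^+ N)%R.
  rewrite -(powR_mulrn N (powR_ge0 _ _)) -powRrM.
  apply: ger_powR; first by rewrite delta0.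
  by rewrite mulrBl lerD2r ltW.
apply: (@le_trans _ _ (2 * (A * delta `^ (D - D')) ^+ N)%R).
  rewrite ler_pM2l// /A !exprMn.
  by rewrite ler_pM ?mulr_ge0 ?exprn_ge0 ?powR_ge0 ?(ltW L10)// ler_pM2l ?exprn_gt0.
apply: (@le_trans _ _ (2 * 2^-1 ^+ N)%R).
  rewrite ler_pM2l// lerXn2r// nnegrE ?mulr_ge0 ?powR_ge0 ?(ltW A0)//.
by rewrite -(prednK N0) exprS mulrA divff// mul1r exprn_ile1// invf_le1// ler1n.
Unshelve. all: by end_near. Qed.

Lemma mdim_le_mdimH {R : realType} {X : ptopologicalType} (T : X -> X)
    (d : X -> X -> R) : compact [set: X] -> continuous T ->
  continuous_pseudometric d -> mdim T d <= mdimH T d.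
Proof.
move=> cX cT hd.
suff main D : mdimH T d < D%:E -> mdim T d <= D%:E.
  have := mdimH_ge0 T d; case E : (mdimH T d) => [x|//|//] x0; last by rewrite leey.
  apply/lee_addgt0Pr => eps eps0; rewrite -EFinD; apply: main.
  by rewrite E lte_fin ltrDl.
move=> HD; have D0 : 0 <= D%:E by apply: le_trans (mdimH_ge0 T d) (ltW HD).
apply: lim_le_near => //; apply: (@near_right0 _ 1) => // e e0 _.
by apply: lim_le_near => //; exact: widim_dyn_le.
Qed.

(** * Comparison of the mean dimensions *)

Theorem proposition3p2 (R : realType) (X : ptopologicalType)
    (T : X -> X) (d : X -> X -> R) (mu : probability (borel X) R)
    (compactX : compact [set: X]) (homeoT : homeomorphism T)
    (metric_d : compatible_metric d) (inv_mu : invariant_measure T mu) :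
  (mdim T d <= mdimH T d /\ mdimH T d <= lower_mdimM T d) /\
  (upper_rdim T d mu <= upper_mdimM T d /\
   lower_rdim T d mu <= lower_mdimM T d).
Proof.
have [cT _] := homeoT.
have hd := compatible_metric_continuous metric_d.
have rate : \forall e \near (0%R : R)^'+,
    rate_distortion T d mu e * ((log2 e^-1)^-1)%:E <=
    S_entropy T d e * ((log2 e^-1)^-1)%:E.
  by apply: near_ratio_le => e e0; exact: rate_distortion_le_S_entropy.
split; split.
- exact: mdim_le_mdimH.
- exact: mdimH_le_lower_mdimM.
- exact: limf_esup_le_near.
- exact: limf_einf_le_near.
Qed.
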